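(* Let $\mathbb{R}^{d} \curvearrowright X$ be a (not necessarily free) Borel flow on a standard Borel space $X$. For $p,q \in \mathbb{N}$ with $p + q \le d$ let $$X_{p,q} = \{x \in X : \mathrm{stab}(x) \in \mathrm{Sgr}_{p,q}(\mathbb{R}^{d})\}.$$ Then the sets $X_{p,q}$ are invariant and Borel, and they partition $X$ into finitely many pieces: $X = \bigsqcup_{p+q \le d} X_{p,q}$. Moreover, for each such pair $(p,q)$, with $r = d - p - q$, there are Borel maps $\beta_{j} : \mathrm{Sgr}_{p,q}(\mathbb{R}^d) \to \mathbb{R}^d$, $1 \le j \le q$, and $\gamma_{k} : \mathrm{Sgr}_{p,q}(\mathbb{R}^d) \to \mathbb{R}^d$, $1 \le k \le r$, such that the formula $$x + (s_{1}, \ldots, s_{r}, t_{1}, \ldots, t_{q}) = x + \sum_{k=1}^{r} s_{k}\gamma_{k}\bigl(\mathrm{stab}(x)\bigr) + \sum_{j=1}^{q} t_{j} \beta_{j}\bigl(\mathrm{stab}(x)\bigr), \qquad x \in X_{p,q},$$ defines a free Borel action $\mathbb{R}^{r} \times \mathbb{T}^{q} \curvearrowright X_{p,q}$ that has the same orbits as the action $\mathbb{R}^{d} \curvearrowright X_{p,q}$.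
   Context: A Borel flow $\mathbb{R}^d \curvearrowright X$ is a Borel measurable action of $\mathbb{R}^d$ on a standard Borel space $X$, written additively. $\mathrm{stab}(x) = \{\vec r \in \mathbb{R}^d : x + \vec r = x\}$, which is a closed subgroup of $\mathbb{R}^d$. $\mathrm{Sgr}(\mathbb{R}^d)$ is the standard Borel space of closed subgroups of $\mathbb{R}^d$, viewed as a Borel subset of the Effros Borel space of closed subsets of $\mathbb{R}^d$ (whose $\sigma$-algebra is generated by the sets $\{F : F \cap U \neq \varnothing\}$, $U$ open), and $\mathrm{Sgr}_{p,q}(\mathbb{R}^d)$ is the set of those closed subgroups that are isomorphic (as topological groups) to $\mathbb{R}^p \times \mathbb{Z}^q$. Here $\mathbb{T} = \mathbb{R}/\mathbb{Z}$, and $t_j \in \mathbb{T}$ is represented by any real number in its class. *)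

(* Defs.v *)
From HB Require Import structures.
From mathcomp Require Import all_boot all_order all_algebra.
From mathcomp Require Import all_classical all_reals all_analysis.
Set Implicit Arguments.
Unset Strict Implicit.
Unset Printing Implicit Defensive.
Import Order.TTheory GRing.Theory Num.Theory numFieldNormedType.Exports.
Local Open Scope classical_set_scope.
Local Open Scope ring_scope.

(* The integers carry the discrete topology, so that 'rV[int]_q is the
   topological group Z^q. *)
HB.instance Definition _ := hasNbhs.Build int principal_filter.
HB.instance Definition _ := Discrete_ofNbhs.Build int erefl.

Section Torus.
Variable R : realType.

(* [int_num_subdef] is the predicate underlying the qualifier [Num.int]: this
   is R/Z, with the quotient group structure and the quotient topology. *)
Definition torus : Type := quotient_topology
  (@Quotient.quot R (GRing.ZmodClosed.clone R (@Num.int_num_subdef R) _)).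

HB.instance Definition _ := Topological.on torus.
HB.instance Definition _ := EqQuotient.on torus.
HB.instance Definition _ := GRing.isZmodule.Build torus
  (@Quotient.addqA R _) (@Quotient.addqC R _)
  (@Quotient.add0q R _) (@Quotient.addNq R _).

Definition torus_pi (x : R) : torus := (\pi_torus x)%qT.

Lemma torus_piB (x y : R) : torus_pi (x - y) = torus_pi x - torus_pi y.
Proof.
rewrite /torus_pi; have piD := @Quotient.pi_add R
  (GRing.ZmodClosed.clone R (@Num.int_num_subdef R) _).
have piN := @Quotient.pi_opp R
  (GRing.ZmodClosed.clone R (@Num.int_num_subdef R) _).
by rewrite [LHS]piD [X in _ = _ + X](esym (piN y)).
Qed.

Lemma torus_pi_eq (x y : R) :
  torus_pi x = torus_pi y <-> exists n : int, x - y = n%:~R.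
Proof.
have E := @Quotient.idealrBE R
  (GRing.ZmodClosed.clone R (@Num.int_num_subdef R) _) x y.
have {}E : (x - y \is a Num.int) <-> torus_pi x = torus_pi y.
  have -> : (x - y \is a Num.int) = (x == y %[mod _])%qT := E.
  by split=> [H|H]; [exact: (elimT eqP H)|apply/eqP; exact: H].
by rewrite -E; split=> /intrP.
Qed.

Lemma torus_pi_surj (a : torus) : exists x : R, torus_pi x = a.
Proof. by exists (repr a); rewrite /torus_pi reprK. Qed.

Lemma torus_pi_continuous : continuous torus_pi.
Proof. exact: pi_continuous. Qed.

Lemma torus_pi_nbhs (x : R) (A : set R) :
  nbhs x A -> nbhs (torus_pi x) (torus_pi @` A).
Proof.
rewrite !nbhsE => -[B [oB Bx] BA]; exists (torus_pi @` B); last exact: image_subset.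
split; last by exists x.
rewrite /open /= /quotient_open.
have -> : \pi_(quotient_topology _)%qT @^-1` (torus_pi @` B) =
    \bigcup_(n in [set: int]) [set y : R | B (y + n%:~R)].
  rewrite eqEsubset; split=> y /=.
    move=> [z Bz /torus_pi_eq[n zy]]; exists n => //=.
    by rewrite -zy addrC subrK.
  move=> [n _ /= Byn]; exists (y + n%:~R) => //.
  by apply/torus_pi_eq; exists n; rewrite addrC addKr.
apply: bigcup_open => n _; apply: open_comp oB => y _.
by apply: (@cvgD R R^o); [exact: cvg_id|exact: cvg_cst].
Qed.

Lemma torus_sub_continuous : continuous (fun x : torus * torus => x.1 - x.2).
Proof.
move=> [a b] U /=; have [x <-] := torus_pi_surj a.
have [y <-] := torus_pi_surj b; rewrite -torus_piB => /torus_pi_continuous.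
move=> /(@sub_continuous R^o (x, y)) [[A B] /= [nA nB] AB].
exists (torus_pi @` A, torus_pi @` B).
  by split; apply: torus_pi_nbhs.
move=> [_ _] /= [[x' Ax <-] [y' By <-]] /=.
by rewrite -torus_piB; exact: (AB (x', y')).
Qed.

HB.instance Definition _ := PreTopologicalNmodule_isTopologicalZmodule.Build
  torus torus_sub_continuous.

Lemma mx_torus_sub_continuous m n :
  continuous (fun x : 'M[torus]_(m, n) * 'M[torus]_(m, n) => x.1 - x.2).
Proof.
move=> [M N] U /= [P nP PU].
have AB i j : exists AB : set torus * set torus, [/\ nbhs (M i j) AB.1,
    nbhs (N i j) AB.2 & forall a b, AB.1 a -> AB.2 b -> P i j (a - b)].
  have := nP i j; rewrite !mxE => /(@sub_continuous torus (M i j, N i j)).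
  move=> [[A B] /= [nA nB] AB]; exists (A, B); split=> // a b Aa Bb.
  exact: (AB (a, b)).
pose F i j := sval (cid (AB i j)).
have FP i j := svalP (cid (AB i j)).
exists ([set M' : 'M[torus]_(m, n) | forall i j, (F i j).1 (M' i j)],
        [set N' : 'M[torus]_(m, n) | forall i j, (F i j).2 (N' i j)]).
  split; first by exists (fun i j => (F i j).1) => // i j; case: (FP i j).
  by exists (fun i j => (F i j).2) => // i j; case: (FP i j).
move=> [M' N'] /= [HM HN]; apply: PU => i j; rewrite !mxE.
by case: (FP i j) => _ _; apply; [exact: HM|exact: HN].
Qed.

(* An alias for R^r x T^q, so that it can carry a [topologicalZmodType]
   structure: the library derives it on products only for tvs factors. *)
Definition RrTq (r q : nat) : Type := ('rV[R]_r * 'rV[torus]_q)%type.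

HB.instance Definition _ r q := GRing.Zmodule.on (RrTq r q).
HB.instance Definition _ r q := Topological.on (RrTq r q).

Lemma RrTq_sub_continuous r q :
  continuous (fun x : RrTq r q * RrTq r q => x.1 - x.2).
Proof.
move=> [[x1 x2] [y1 y2]] U /= [[P Q] /= [nP nQ] PQU].
have [[P1 P2] /= [nP1 nP2] P12] := @sub_continuous 'rV[R]_r (x1, y1) P nP.
have [[Q1 Q2] /= [nQ1 nQ2] Q12] := @mx_torus_sub_continuous 1 q (x2, y2) Q nQ.
exists (P1 `*` Q1, P2 `*` Q2).
  by split; [exists (P1, Q1)|exists (P2, Q2)].
move=> [[u1 u2] [v1 v2]] /= [[Pu Qu] [Pv Qv]]; apply: (PQU (_, _)).
by split; [exact: (P12 (u1, v1))|exact: (Q12 (u2, v2))].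
Qed.

HB.instance Definition _ r q := PreTopologicalNmodule_isTopologicalZmodule.Build
  (RrTq r q) (@RrTq_sub_continuous r q).

End Torus.

(* An alias for G, as a measurable space with the sigma-algebra generated by
   its open sets. *)
Definition borel (G : topologicalZmodType) : Type := G.

Section BorelGroup.
Variable G : topologicalZmodType.
Notation opens := (@open G).

Lemma borelC (A : set (borel G)) : <<s opens >> A -> <<s opens >> (~` A).
Proof. by rewrite -setTD; exact: sigma_algebraCD. Qed.

HB.instance Definition _ := Choice.on (borel G).
HB.instance Definition _ := isPointed.Build (borel G) 0.
HB.instance Definition _ := @isMeasurable.Build (sigma_display opens) (borel G)
  <<s opens >> (@sigma_algebra0 _ setT opens) borelC
  (@sigma_algebra_bigcup _ setT opens).
End BorelGroup.

Definition polish (R : realType) (P : metricType R) : Prop :=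
  (forall F : set_system P, ProperFilter F -> cauchy F -> exists l : P, F --> l) /\
  exists2 S : set P, countable S & dense S.

(* Isomorphic, as a measurable space, to a Polish space with its Borel sets. *)
Definition standard_borel (R : realType) (disp : measure_display)
    (X : measurableType disp) : Prop :=
  exists (P : metricType R) (f : X -> P), [/\ polish P, bijective f
    & forall A : set X, measurable A <-> <<s @open P >> (f @` A)].

Section Action.
Context {disp : measure_display} {X : measurableType disp}.
Context {G : topologicalZmodType}.
Implicit Types (D : set X) (act : X -> G -> X).

Definition invariant_set act D : Prop := forall x g, D x -> D (act x g).

(* [act] restricts to a Borel action of G on D; its values outside of D are
   irrelevant. *)
Definition borel_action D act : Prop :=
  [/\ measurable D, invariant_set act D,
      forall x, D x -> act x 0 = x,
      forall x g h, D x -> act x (g + h) = act (act x g) h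
    & measurable_fun (D `*` setT : set (X * borel G))
        (fun xg : X * borel G => act xg.1 xg.2)].

Definition free_action D act : Prop :=
  forall x g, D x -> act x g = x -> g = 0.

Definition orbit_of act (x : X) : set X := range (act x).

Definition stab act (x : X) : set G := [set g | act x g = x].

End Action.

Section Subgroups.
Variables (R : realType) (d : nat).
Notation V := 'rV[R]_d.

Definition Sgr : set (set V) := [set H : set V |
  [/\ closed H, H 0 & forall u v : V, H u -> H v -> H (u - v)]].

(* Here [psi] restricts to the inverse of the isomorphism [phi] onto [H]. *)
Definition top_group_iso (p q : nat) (H : set V) : Prop :=
  exists (phi : 'rV[R]_p * 'rV[int]_q -> V) (psi : V -> 'rV[R]_p * 'rV[int]_q),
    [/\ forall u v, phi (u + v) = phi u + phi v,
        range phi = H, cancel phi psi,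
        continuous phi & {within H, continuous psi}].

Definition Sgr_pq (p q : nat) : set (set V) :=
  [set H | Sgr H /\ top_group_iso p q H].

(* The Effros Borel structure, a sigma-algebra on the set of closed subsets. *)
Definition effros : set (set (set V)) :=
  <<s [set F : set V | closed F],
      [set [set F : set V | closed F /\ F `&` U !=set0] | U in @open V] >>.

(* f is Borel on S with the Borel structure induced by the Effros space. *)
Definition effros_borel_on (S : set (set V)) (f : set V -> V) : Prop :=
  forall B : set (borel V), measurable B ->
    exists2 E, effros E & S `&` f @^-1` B = S `&` E.

Definition stratum (disp : measure_display) (X : measurableType disp)
    (flow : X -> V -> X) (p q : nat) : set X :=
  [set x | Sgr_pq p q (stab flow x)].

End Subgroups.

(* Main.v *)
Require Import Defs.
From HB Require Import structures.
From mathcomp Require Import all_boot all_order all_algebra finmap.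
From mathcomp Require Import all_classical all_reals all_analysis.
From mathcomp Require Import measurable_realfun.
From mathcomp Require Import zify ring lra.
Set Implicit Arguments.
Unset Strict Implicit.
Unset Printing Implicit Defensive.
Import Order.TTheory GRing.Theory Num.Theory numFieldNormedType.Exports.
Local Open Scope classical_set_scope.
Local Open Scope ring_scope.

(* Baire category replaces any compact model of the flow. Fix a countable
   separating family A_n of Borel sets of X. If x + h <> x, then
   {v | x + v in A_n, x + h + v not in A_n} is nonmeager for some n, hence
   comeager in some ball; consequently h lies outside stab x exactly when, for
   some n and some rational data close to h, the set {v | x + v in A_n} is
   nonmeager in a ball and meager in a larger translate of it. Those category
   conditions are Borel in x (Montgomery-Novikov), so stab x is closed and
   depends measurably on x.

   A closed subgroup H is a linear space L plus a lattice. Choose coordinates c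
   such that W_c = {v | v_(c i) = 0} is a complement of L; then the intersection
   of H and W_c is discrete and free of rank q, and each of its points is the
   unique point of H, W_c and some rational ball, which makes it a measurable
   function of H. The number of coordinates is minimal exactly when W_c
   complements L. A Z-basis among these points, completed by unit vectors, is
   found by a countable search: beta is the basis, gamma the unit vectors, and
   (s, t) |-> s gamma + t beta induces an isomorphism of R^r x T^q onto R^d / H. *)

(** The obstacle is quantification over uncountable sets. Asking whether stab(x) meets an open set
    quantifies over all h, which a priori gives only an analytic condition. Writing the pairs (x, h)
    with x + h <> x as a countable union of rectangles, Borel in x and open in h, avoids this:
    compactness turns missing a compact set into a finite covering condition.

    For the same reason no basis of L is selected: L meets a ball in more than one point unless it
    is trivial, so no unique points are available. The unit vectors at the coordinates c replace
    such a basis, because they and L both complement W_c; independence of beta and gamma modulo L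
    then becomes a nonzero determinant. Discreteness of the lattice part only says that L and W_c
    meet in 0, so dim L is at most the number of coordinates; excluding shorter lists of coordinates
    forces equality. *)

Section RationalBalls.
Variables (R : realType) (d : nat).
Notation V := 'rV[R]_d.

Definition rvec (c : 'rV[rat]_d) : V := map_mx ratr c.

(** A nonpositive radius gives the empty ball, which is why nonemptiness of [rball j] is demanded
    separately below. *)
Definition rball (i : 'rV[rat]_d * rat) : set V := ball (rvec i.1) (ratr i.2).

Lemma ball_normP (x : V) (e : R) (y : V) : ball x e y <-> `|x - y| < e.
Proof. by rewrite -ball_normE. Qed.

Lemma coord_norm_le (v : V) j : `|v 0 j| <= `|v|.
Proof.
rewrite [leRHS]/Num.Def.normr /= mx_normrE; apply: (bigmax_sup (0, j)) => //=.
Qed.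

Lemma norm_lt_coord (v : V) (e : R) :
  0 < e -> (forall j, `|v 0 j| < e) -> `|v| < e.
Proof.
move=> e0 ve; rewrite [ltLHS]/Num.Def.normr /= mx_normrE; apply/bigmax_ltP; split=> //.
by move=> [i j] _ /=; rewrite ord1.
Qed.

Lemma rat_between (x y : R) : x < y -> exists q : rat, x < ratr q < y.
Proof.
move=> xy; have [] := @dense_rat R `]x, y[%classic.
- by exists ((x + y) / 2); rewrite /= in_itv /=; apply/andP; split; lra.
- exact: interval_open.
by move=> a [/= + [q _ qa]]; rewrite -qa in_itv /= => aq; exists q.
Qed.

Lemma rvec_approx (v : V) (e : R) : 0 < e -> exists c, `|v - rvec c| < e.
Proof.
move=> e0.
have H j : exists q : rat, v 0 j - e < ratr q < v 0 j + e.
  by apply: rat_between; lra.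
exists (\row_j sval (cid (H j))); apply: norm_lt_coord => // j.
rewrite !mxE; case: cid => q /= /andP[q1 q2]; rewrite ltr_norml.
by apply/andP; split; lra.
Qed.

Lemma rball_open i : open (rball i). Proof. exact: ball_open. Qed.

Lemma rball_sub (v : V) (e : R) : 0 < e ->
  exists i, rball i v /\ rball i `<=` ball v e.
Proof.
move=> e0; have e2 : 0 < e / 2 by rewrite divr_gt0.
have [a /andP[a0 ae]] := rat_between e2.
have [c vc] := rvec_approx v a0; exists (c, a); split.
  by apply/ball_normP; rewrite distrC.
move=> w /ball_normP cw; apply/ball_normP => /=.
rewrite (splitr e) -(subrK (rvec c) v) -addrA (le_lt_trans (ler_normD _ _))//.
by rewrite ltrD// (lt_trans _ ae).
Qed.

Lemma rball_nbhs (v : V) (U : set V) : nbhs v U ->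
  exists i, rball i v /\ rball i `<=` U.
Proof.
move=> /nbhs_ballP[e /= e0 vU]; have [i [iv ie]] := rball_sub v e0.
by exists i; split=> //; exact: subset_trans vU.
Qed.

End RationalBalls.

(** * Meager sets and the Baire property in R^d *)

Section Meager.
Variables (R : realType) (d : nat).
Notation V := 'rV[R]_d.
Implicit Types (A B U : set V).
Local Notation rball := (@rball R d).

Lemma rV_baire (F : (set V)^nat) :
  (forall i, open (F i) /\ dense (F i)) -> dense (\bigcap_i F i).
Proof.
pose C : completeNormedModType R := HB.pack V (Complete.on V).
exact: (@Baire R C).
Qed.

Definition meager A := exists D : (set V)^nat,
  (forall i, open (D i) /\ dense (D i)) /\ A `<=` ~` \bigcap_i D i.

Lemma meagerS A B : A `<=` B -> meager B -> meager A.
Proof. by move=> AB [D [HD BD]]; exists D; split=> // x /AB /BD. Qed.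

Lemma meager_bigcup (I : countType) (F : I -> set V) :
  (forall i, meager (F i)) -> meager (\bigcup_i F i).
Proof.
move=> mF; pose D i := sval (cid (mF i)).
(* One sequence runs through all pairs (i, k); numbers that code no pair contribute the dense open
   set [setT]. *)
pose E n := if choice.unpickle n is Some (i, k) then D i k else setT.
exists E; split=> [n|x [i _ Fx] DE].
  rewrite /E; case: choice.unpickle => [[i k]|].
    by rewrite /D; case: cid => /= G [+ _]; exact.
  by split; [exact: openT|move=> O O0 _; rewrite setIT].
have := svalP (cid (mF i)) => -[_ /(_ _ Fx)]; apply => k _.
by have := DE (choice.pickle (i, k)) Logic.I; rewrite /E choice.pickleK.
Qed.

Lemma meager0 : meager set0.
Proof.
exists (fun=> setT); split=> // n.
by split; [exact: openT|move=> O O0 _; rewrite setIT].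
Qed.

Lemma meagerU A B : meager A -> meager B -> meager (A `|` B).
Proof.
move=> mA mB; have := @meager_bigcup bool (fun b => if b then A else B).
move=> H; apply: meagerS (H _) => [x []|[]//]; first by exists true.
by exists false.
Qed.

Lemma open_nonmeager U : open U -> U !=set0 -> ~ meager U.
Proof.
by move=> oU U0 [D [/rV_baire dD UD]]; have [x [/UD]] := dD U U0 oU.
Qed.

Lemma meager_open_dense U : open U -> dense U -> meager (~` U).
Proof.
move=> oU dU; exists (fun=> U); split=> // x Ux; apply: contra_not Ux.
by move=> /(_ 0 I).
Qed.

Lemma meager_translate A (h : V) : meager A -> meager [set v | A (v + h)].
Proof.
have ct (k : V) : continuous (fun v : V => v + k).
  by move=> v; apply: (@cvgD R V _ (nbhs v) _ id (cst k) v k); [exact: cvg_id|exact: cvg_cst].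
move=> [D [HD AD]]; exists (fun i => [set v | D i (v + h)]); split=> [i|v /= /AD].
  have [oD dD] := HD i; split; first by apply: open_comp oD => v _; exact: ct.
  move=> O [y Oy] oO.
  have [||z [Oz Dz]] := dD [set v | O (v - h)].
  - by exists (y + h); rewrite /= addrK.
  - by apply: open_comp oO => v _; exact: ct.
  by exists (z - h); split=> //=; rewrite subrK.
by apply: contra_not => H i _; exact: H.
Qed.

(* A form of the Baire property that is visibly closed under complements and
   countable unions. *)
Definition locally_comeager A := forall i, meager (A `&` rball i) \/
  exists j, [/\ rball j !=set0, rball j `<=` rball i & meager (rball j `\` A)].

(** The subballs in which [A] is comeager are dense in [rball i]. Outside [A], their union
    contributes a countable union of meager sets, and what they miss is nowhere dense. *)
Lemma locally_comeagerN A i : locally_comeager A ->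
  (forall j, rball j !=set0 -> rball j `<=` rball i -> ~ meager (A `&` rball j)) ->
  meager (rball i `\` A).
Proof.
move=> lA H.
pose good j := rball j !=set0 /\ rball j `<=` rball i /\ meager (rball j `\` A).
pose W := \bigcup_(j in good) rball j.
(* Adding the exterior of the ball makes the open set dense in the whole space. *)
pose W' := W `|` ~` closure (rball i).
have oW : open W by apply: bigcup_open => j _; exact: rball_open.
have oW' : open W' by apply: openU => //; exact/closed_openC/closed_closure.
have dW' : dense W'.
  move=> O [y Oy] oO; have [iy|niy] := pselect (closure (rball i) y); last first.
    by exists y; split=> //; right.
  have [z [iz Oz]] := iy O (open_nbhs_nbhs (conj oO Oy)).
  have [j [jz jO]] : exists j, rball j z /\ rball j `<=` rball i `&` O.
    apply: rball_nbhs; apply: filterI.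
      exact: (open_nbhs_nbhs (conj (@rball_open _ _ i) iz)).
    exact: (open_nbhs_nbhs (conj oO Oz)).
  have jO1 : rball j `<=` rball i by move=> x /jO[].
  have := lA j; move=> [/(H j (ex_intro _ z jz) jO1)[]|[k [[t kt] kj mk]]].
  exists t; split; first by have [] := jO _ (kj _ kt).
  left; exists k => //; split; first by exists t.
  by split=> //; exact: subset_trans kj _.
apply: (@meagerS _ ((\bigcup_j (if `[<good j>] then rball j `\` A else set0)) `|` ~` W')).
  move=> x [ix Ax]; have [Wx|nWx] := pselect (W x).
    left; case: Wx => j gj jx; exists j => //.
    by case: asboolP => // _; split.
  by right; move=> -[//|]; apply; exact: subset_closure.
apply: meagerU; last exact: meager_open_dense.
apply: meager_bigcup => j; case: asboolP => [[_ []]//|_]; exact: meager0.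
Qed.

Lemma locally_comeagerC A : locally_comeager A -> locally_comeager (~` A).
Proof.
move=> lA i; have [[j [j0 ji mj]]|H] := pselect (exists j,
    [/\ rball j !=set0, rball j `<=` rball i & meager (A `&` rball j)]).
  right; exists j; split=> //; apply: meagerS mj => x [jx]/=.
  by rewrite notK.
left; rewrite setIC -setDE; apply: locally_comeagerN => // j j0 ji mj.
by apply: H; exists j.
Qed.

Lemma locally_comeager_bigcup (F : (set V)^nat) :
  (forall n, locally_comeager (F n)) -> locally_comeager (\bigcup_n F n).
Proof.
move=> lF i; have [H|/existsNP[n nF]] := pselect (forall n, meager (F n `&` rball i)).
  by left; rewrite setI_bigcupl; exact: meager_bigcup.
right; have [//|[j [j0 ji mj]]] := lF n i; exists j; split=> //.
by apply: meagerS mj => x [jx nx]; split=> // Fx; apply: nx; exists n.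
Qed.

Lemma locally_comeager_open U : open U -> locally_comeager U.
Proof.
move=> oU i; have [[x [Ux ix]]|/set0P/negP/negPn/eqP->] :=
    pselect (U `&` rball i !=set0); last by left; exact: meager0.
have [j [jx jU]] : exists j, rball j x /\ rball j `<=` U `&` rball i.
  apply: rball_nbhs; apply: filterI; first exact: open_nbhs_nbhs.
  exact: (open_nbhs_nbhs (conj (@rball_open _ _ i) ix)).
right; exists j; split; [by exists x|by move=> y /jU[]|].
by apply: meagerS meager0 => y [/jU[]].
Qed.

(** Turns meagerness of a complement into a countable conjunction of conditions on [A]; this carries
    measurability through complements. *)
Lemma meagerC_rball A i : locally_comeager A ->
  meager (~` A `&` rball i) <->
  forall j, rball j !=set0 -> rball j `<=` rball i -> ~ meager (A `&` rball j).
Proof.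
move=> lA; rewrite setIC -setDE; split=> [mA j j0 ji mj|H]; last first.
  exact: locally_comeagerN.
apply: (open_nonmeager (@rball_open R d j) j0).
apply: (meagerS _ (meagerU mA mj)) => x jx.
have [Ax|Ax] := pselect (A x); first by right.
by left; split=> //; exact: ji.
Qed.

End Meager.

(** * Category of the sections of Borel sets *)

Section BorelSets.
Variables (R : realType) (d : nat).
Notation V := 'rV[R]_d.

Lemma measurable_borel_locally_comeager (A : set (borel V)) :
  measurable A -> @locally_comeager R d A.
Proof.
move: A; apply: smallest_sub; last exact: locally_comeager_open.
split=> [|A|F]; first exact/locally_comeager_open/open0.
- by rewrite setTD; exact: locally_comeagerC.
- exact: locally_comeager_bigcup.
Qed.

(* Montgomery-Novikov *)
Lemma measurable_section_meager disp (X : measurableType disp)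
    (A : set (X * borel V)) : measurable A ->
  (forall x, @locally_comeager R d [set v | A (x, v)]) /\
  forall i, measurable [set x | meager ([set v : V | A (x, v)] `&` @rball R d i)].
Proof.
(* Both properties are proved together, since the complement step of the second relies on the first.
   Generators are preimages under the two projections. *)
move: A; pose C := [set A : set (X * borel V) |
  (forall x, @locally_comeager R d [set v | A (x, v)]) /\
  forall i, measurable [set x | meager ([set v : V | A (x, v)] `&` @rball R d i)]].
apply: (@smallest_sub _ _ _ C); last first.
  move=> A [] [B mB]; rewrite setTI => <-; split=> [x|i] /=.
  - have [Bx|nBx] := pselect (B x).
      by rewrite (_ : mkset _ = setT) ?predeqE//; exact/locally_comeager_open/openT.
    by rewrite (_ : mkset _ = set0) ?predeqE//; exact/locally_comeager_open/open0.
  - have [i0|i0] := pselect (@rball R d i !=set0).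
      rewrite (_ : mkset _ = ~` B); first exact: measurableC.
      rewrite predeqE => x; split=> /= [mi Bx|nBx].
        apply: (@open_nonmeager R d (rball i)) => //; first exact: rball_open.
        by apply: meagerS mi => v iv; split.
      by apply: meagerS (@meager0 R d) => v [].
    rewrite (_ : mkset _ = setT); first exact: measurableT.
    rewrite predeqE => x; split=> //= _; apply: meagerS (@meager0 R d) => v [_ iv].
    by apply: i0; exists v.
  - exact: measurable_borel_locally_comeager.
  - have [H|H] := pselect (meager ((B : set V) `&` @rball R d i)).
      by rewrite (_ : mkset _ = setT) ?predeqE.
    by rewrite (_ : mkset _ = set0) ?predeqE.
split=> [|A [lA mA]|F lF].
- split=> [x|i]; first exact/locally_comeager_open/open0.
  rewrite (_ : mkset _ = setT) ?predeqE// => x; split=> // _.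
  by apply: meagerS (@meager0 R d) => v [].
- rewrite setTD; split=> [x|i]; first exact: (locally_comeagerC (lA x)).
  rewrite (_ : mkset _ = \bigcap_j ~` (if `[<@rball R d j !=set0 /\ @rball R d j `<=` rball i>]
    then [set x | meager ([set v | A (x, v)] `&` @rball R d j)] else set0)).
    rewrite -setC_bigcup; apply: measurableC.
    apply: countable_bigcupT_measurable => [|j]; first exact: countableP.
    by case: asboolP => // _; exact: mA.
  rewrite predeqE => x; split=> [/(meagerC_rball _ (lA x)) H j _|H].
    by case: asboolP => [[j0 ji]|_ []]; exact: H.
  apply/(meagerC_rball _ (lA x)) => j j0 ji.
  by have := H j I; case: asboolP => // -[].
- split=> [x|i].
    rewrite (_ : mkset _ = \bigcup_n [set v | F n (x, v)]).
      by apply: locally_comeager_bigcup => n; have [+ _] := lF n; exact.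
    by rewrite predeqE => v.
  rewrite (_ : mkset _ = \bigcap_n [set x | meager ([set v | F n (x, v)] `&` @rball R d i)]).
    by apply: bigcap_measurableType => n _; have [_ +] := lF n; exact.
  rewrite predeqE => x; split=> [H n _ /=|H /=].
    by apply: meagerS H => v [Fv iv]; split=> //; exists n.
  apply: (@meagerS _ _ _ (\bigcup_n ([set v | F n (x, v)] `&` @rball R d i))).
    by move=> v [[n _ Fv] iv]; exists n.
  by apply: meager_bigcup => n; exact: H.
Qed.

End BorelSets.

(** The sets are balls of radius [1/(k+1)] around a dense set. A centre is addressed by its code
    under an injection into the naturals; a number that codes no centre yields the empty set. *)
Lemma standard_borel_separating (R : realType) disp (X : measurableType disp) :
  standard_borel R X -> exists A : nat * nat -> set X,
    (forall i, measurable (A i)) /\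
    forall x y, x <> y -> exists i, A i x /\ ~ A i y.
Proof.
move=> [P [f [[_ [S /countable_injP[g ginj] dS]] [f' fK f'K] fm]]].
pose A (i : nat * nat) := [set x | exists s,
  [/\ S s, g s = i.1 & ball s (i.2.+1%:R^-1 : R) (f x)]].
exists A; split=> [i|x y xy].
  apply/fm; apply: (@sub_sigma_algebra _ setT (@open P)).
  suff -> : f @` A i = \bigcup_(s in [set s | S s /\ g s = i.1]) (ball s (i.2.+1%:R^-1 : R))^°.
    by apply: bigcup_open => s _; exact: open_interior.
  rewrite predeqE => z; split=> [[x [s [Ss gs sx]] <-]|[s [Ss gs] sz]].
    exists s; first by [].
    rewrite /interior; have := sx; rewrite ballEmdist /= => sx'.
    apply/nbhs_ballP; exists (i.2.+1%:R^-1 - mdist s (f x)) => /=; first by rewrite subr_gt0.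
    move=> w; rewrite ballEmdist /= ltrBrDl => wx.
    exact: le_lt_trans (metric_triangle _ (f x) _) wx.
  exists (f' z); last by rewrite f'K.
  by exists s; split=> //; rewrite f'K; exact: interior_subset sz.
have e0 : 0 < mdist (f x) (f y).
  by rewrite mdist_gt0; apply/eqP => /(congr1 f'); rewrite !fK.
have [k _ kd] : exists2 k, True & (k.+1%:R^-1 : R) < mdist (f x) (f y) / 2.
  have e2 : 0 < mdist (f x) (f y) / 2 by rewrite divr_gt0.
  by have [k _ kd] := near_infty_natSinv_lt (PosNum e2); exists k => //; apply: kd => /=.
have k0 : 0 < k.+1%:R^-1 :> R by rewrite invr_gt0.
have [s [xs Ss]] : ((ball (f x) (k.+1%:R^-1 : R))^° `&` S) !=set0.
  apply: dS; last exact: open_interior.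
  by exists (f x); apply: nbhsx_ballx.
move/interior_subset : xs => xs.
exists (g s, k); split; first by exists s; split=> //; exact: ball_sym.
move=> [s' [Ss' /ginj]]; rewrite !inE => /(_ Ss' Ss) -> /= sy.
have := ball_triangle xs sy; rewrite ballEmdist /= ltNge => /negP; apply.
by rewrite (splitr (mdist _ _)) ltW// ltrD.
Qed.

(** * The non-stabilizing pairs as countably many rectangles *)

Section Stabilizer.
Variables (R : realType) (d : nat) (disp : measure_display).
Variables (X : measurableType disp) (flow : X -> 'rV[R]_d -> X).
Notation V := 'rV[R]_d.
Hypothesis sX : standard_borel R X.
Hypothesis Hflow : borel_action setT flow.

Lemma flow0 x : flow x 0 = x. Proof. by case: Hflow => _ _ + _ _; exact. Qed.

Lemma flowD x g h : flow x (g + h) = flow (flow x g) h.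
Proof. by case: Hflow => _ _ _ + _; exact. Qed.

Lemma measurable_flow : measurable_fun setT (fun xg : X * borel V => flow xg.1 xg.2).
Proof. by case: Hflow => _ _ _ _; rewrite setXTT. Qed.

Lemma measurable_orbit (A : set X) x : measurable A ->
  measurable ([set v | A (flow x v)] : set (borel V)).
Proof.
move=> mA; have := measurable_xsection x (measurable_flow measurableT mA).
rewrite setTI; congr measurable; rewrite predeqE => v.
by rewrite /xsection /= inE.
Qed.

Lemma stabC_bigcup : exists (J : countType) (M : J -> set X) (U : J -> set V),
  [/\ forall j, measurable (M j), forall j, open (U j) &
    forall x h, flow x h <> x <-> exists2 j, M j x & U j h].
Proof.
have [A [mA sepA]] := standard_borel_separating sX.
pose At n x : set V := [set v | A n (flow x v)].
(* The second radius is doubled because a point of the ball (c, a), moved by an h in the ball (b,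
   a), lies within 2a of c + b. *)
pose M (j : (nat * nat) * 'rV[rat]_d * 'rV[rat]_d * rat) : set X :=
  [set x | ~ meager (At j.1.1.1 x `&` @rball R d (j.1.1.2, j.2)) /\
     meager (At j.1.1.1 x `&` @rball R d (j.1.1.2 + j.1.2, 2 * j.2))].
have mm n i : measurable [set x | meager (At n x `&` @rball R d i)].
  have := measurable_flow measurableT (mA n); rewrite setTI.
  by move=> /measurable_section_meager[_ /(_ i)].
exists _, M, (fun j => @rball R d (j.1.2, j.2)); split=> [j|j|x h].
- by apply: measurableI; [apply: (@measurableC _ _ [set x | meager _])|]; exact: mm.
- exact: rball_open.
have rD (c b : 'rV[rat]_d) : rvec R (c + b) = rvec R c + rvec R b by apply/rowP => k; rewrite !mxE rmorphD.
have r2 (a : rat) : ratr (2 * a) = ratr a + ratr a :> R.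
  by rewrite rmorphM /= ratr_nat mulr_natl mulr2n.
split=> [xh|[[[[n c] b] a] [/= nm m] /ball_normP/= hb xh]].
  (* Since x and x + h differ, so do x + v and x + h + v for every v; Baire's theorem then singles
     out one separating set. *)
  have cov : [set: V] = \bigcup_i (At i x `\` At i (flow x h)).
    rewrite predeqE => v; split=> // _.
    have : flow x v <> flow (flow x h) v.
      move=> /(congr1 (flow^~ (- v))); rewrite -!flowD ?addrA ?addrK ?subrr ?addr0 ?addrK.
      by rewrite flow0 => /esym.
    by move=> /sepA[i [xv xhv]]; exists i.
  have [i nmE] : exists i, ~ meager (At i x `\` At i (flow x h)).
    apply/existsNP => H; apply: (@open_nonmeager R d setT openT); first by exists 0.
    by rewrite cov; exact: meager_bigcup.
  set E := At i x `\` _ in nmE.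
  have lE : locally_comeager E.
    by apply: measurable_borel_locally_comeager; apply: measurableD; exact: measurable_orbit.
  have [k nmk] : exists k, ~ meager (E `&` @rball R d k).
    apply/existsNP => H; apply: nmE; apply: meagerS (meager_bigcup H) => v Ev.
    have [k [kv _]] := rball_nbhs (@filterT _ (nbhs v) _).
    by exists k.
  have [//|[j [[c0 jc0] jk mj]]] := lE k.
  have /nbhs_ballP[e /= e0 je] := open_nbhs_nbhs (conj (@rball_open R d j) jc0).
  (* The longest estimate below adds up to [a + 2a + a]. *)
  have e4 : 0 < e / 4 by rewrite divr_gt0.
  have [a /andP[a0 ae]] := rat_between e4.
  have [c cc0] := rvec_approx c0 a0.
  have [b bh] := rvec_approx h a0.
  exists (i, c, b, a); last by apply/ball_normP; rewrite distrC.
  split=> /=.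
    move=> mc; apply: (@open_nonmeager R d (rball (c, a))); first exact: rball_open.
      by exists (rvec R c); exact: ballxx.
    apply: meagerS (meagerU mc mj) => v /[dup] cav /ball_normP/= cv.
    have [Av|nAv] := pselect (At i x v); first by left.
    right; split; last by move=> [].
    apply/je/ball_normP; rewrite -(subrK (rvec R c) c0) -addrA.
    by rewrite (le_lt_trans (ler_normD _ _))//; lra.
  apply: (meagerS _ (meager_translate (- h) mj)) => v [Av].
  rewrite /rball /= rD r2 => /ball_normP cv; split; last first.
    by move=> [_]; apply; rewrite /At /= -flowD addrC subrK.
  apply/je/ball_normP.
  rewrite (_ : _ - _ = (c0 - rvec R c) + (rvec R c + rvec R b - v) + (h - rvec R b)).
    rewrite (le_lt_trans (ler_normD _ _))//.
    by have := ler_normD (c0 - rvec R c) (rvec R c + rvec R b - v); lra.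
  by apply/rowP => l; rewrite !mxE; ring.
(* If h fixes x, translation by h preserves [At n x], so meagerness near c + b moves back to the
   ball around c. *)
apply: nm; apply: meagerS (meager_translate h m) => v [Av /ball_normP/= cv]; split.
  by rewrite /At /= addrC flowD xh.
rewrite /rball /= rD r2; apply/ball_normP.
rewrite (_ : _ - _ = (rvec R c - v) + (rvec R b - h)).
  by rewrite (le_lt_trans (ler_normD _ _))// ltrD.
by rewrite opprD addrACA.
Qed.

End Stabilizer.

(** * Hitting compact sets, and measurable choice of unique points *)

Section CompactHits.
Variables (R : realType) (d : nat).
Notation V := 'rV[R]_d.

Definition cball (i : 'rV[rat]_d * rat) : set V :=
  [set v | `|rvec R i.1 - v| <= ratr i.2].

Lemma cball_compact i : compact (cball i).
Proof.
apply: bounded_closed_compact.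
  exists (`|rvec R i.1| + ratr i.2); split; first exact: num_real.
  move=> M HM v /= iv; apply: le_trans (ltW HM).
  rewrite -(subrK (rvec R i.1) v) addrC (le_trans (ler_normD _ _))// lerD2l//.
  by rewrite distrC.
have c : continuous (fun v : V => `|rvec R i.1 - v|).
  move=> v; apply: (@cvg_norm R V _ (nbhs v) _ (fun v => rvec R i.1 - v)).
  by apply: (@cvgB R V _ (nbhs v) _ (cst _) id); [exact: cvg_cst|exact: cvg_id].
change (closed ((fun v : V => `|rvec R i.1 - v|) @^-1` [set y | y <= ratr i.2])).
by apply: preimage_closed; [move=> v _; exact: c|exact: closed_le].
Qed.

Lemma cball_sub (v : V) (U : set V) : nbhs v U ->
  exists i, @rball R d i v /\ cball i `<=` U.
Proof.
move=> /nbhs_ballP[e /= e0 vU]; have e2 : 0 < e / 2 by rewrite divr_gt0.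
have [a /andP[a0 ae]] := rat_between e2.
have [c vc] := rvec_approx v a0; exists (c, a); split.
  by apply/ball_normP; rewrite distrC.
move=> w cw; apply/vU/ball_normP => /=; rewrite /cball /= in cw.
rewrite -(subrK (rvec R c) v) -addrA (le_lt_trans (ler_normD _ _))//.
lra.
Qed.

Lemma rball_cball i : @rball R d i `<=` cball i.
Proof. by move=> v /ball_normP /ltW. Qed.

Lemma open_bigcup_cball (U : set V) : open U ->
  U = \bigcup_(i in [set i | cball i `<=` U]) cball i.
Proof.
move=> oU; rewrite predeqE => v; split=> [Uv|[i iU /iU]//].
have [i [iv iU]] := cball_sub (open_nbhs_nbhs (conj oU Uv)).
by exists i => //; exact: rball_cball.
Qed.

(** [K] misses [Phi x] exactly when the [U j] with [M j x] cover it, and finitely many of them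
    suffice; there are only countably many finite sets of indices. *)
Lemma measurable_compact_hit disp (T : measurableType disp) (Phi : T -> set V)
    (J : countType) (M : J -> set T) (U : J -> set V) :
  (forall j, measurable (M j)) -> (forall j, open (U j)) ->
  (forall x h, ~ Phi x h <-> exists2 j, M j x & U j h) ->
  forall K : set V, compact K -> measurable [set x | Phi x `&` K !=set0].
Proof.
move=> mM oU PhiE K cK.
rewrite (_ : mkset _ = ~` \bigcup_(s : {fset J})
    (if `[<K `<=` cover [set` s] U>] then \bigcap_(j in [set` s]) M j else set0)).
  apply/measurableC/countable_bigcupT_measurable => [|s]; first exact: countableP.
  case: asboolP => // _; apply: fin_bigcap_measurable => [|j _]; [exact: finite_fset|exact: mM].
rewrite predeqE => x; split=> [[v [xv Kv]] [s _]|H].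
  case: asboolP => // /(_ v Kv) [j sj Uv] /(_ j sj) Mx.
  by apply/(PhiE x v): xv; exists j.
apply: contrapT => PK; apply: H.
have cov : K `<=` cover [set j | M j x] U.
  move=> v Kv; have /PhiE[j Mj Uj] : ~ Phi x v by move=> xv; apply: PK; exists v.
  by exists j.
have [s sM sK] : finite_subset_cover [set j | M j x] U K.
  by move: cK; rewrite compact_cover; apply.
exists s => //; case: asboolP => // _ j /sM; by rewrite inE.
Qed.

Definition hits : set (set (set V)) :=
  [set [set F : set V | F `&` U !=set0] | U in @open V].

(* A sigma-algebra on all subsets of V; its trace on the closed ones is the
   Effros structure. *)
Definition hit_space := g_sigma_algebraType hits.

Lemma measurable_hit (U : set V) : open U ->
  measurable ([set F | F `&` U !=set0] : set hit_space).
Proof. by move=> oU; apply: sub_sigma_algebra; exists U. Qed.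

(** Open sets cannot tell [F] from its closure. The complement of the closure is the union of the
    rational balls that [F] misses, which is the rectangle form needed above. *)
Lemma measurable_closure_hit (K : set V) : compact K ->
  measurable ([set F | closure F `&` K !=set0] : set hit_space).
Proof.
apply: (@measurable_compact_hit _ hit_space (fun F => closure (F : set V)) _
   (fun i => ~` [set F | F `&` @rball R d i !=set0]) (@rball R d)).
- by move=> i; apply: measurableC; apply: (@measurable_hit (@rball R d i)); exact: rball_open.
- exact: rball_open.
move=> F v; split=> [nF|[i Fi iv] /(_ _ (open_nbhs_nbhs (conj (@rball_open R d i) iv)))//].
have /rball_nbhs[i [iv iF]] : nbhs v (~` closure F).
  by apply: open_nbhs_nbhs; split=> //; exact/closed_openC/closed_closure.
exists i => // -[w [Fw /iF]]; apply; exact: subset_closure.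
Qed.

Definition pick_point (K : set V) (F : hit_space) : V :=
  xget 0 [set v | closure (F : set V) `&` K = [set v]].

Definition singly_hit (K : set V) : set hit_space :=
  [set F | exists v, closure (F : set V) `&` K = [set v]].

(** A second point is detected by two disjoint closed rational balls that are both hit inside [K], a
    countable condition. *)
Lemma measurable_singly_hit (K : set V) : compact K -> measurable (singly_hit K).
Proof.
move=> cK; have cKi i : compact (K `&` cball i).
  by apply: compact_closedI => //; apply: compact_closed; [exact: norm_hausdorff|exact: cball_compact].
rewrite (_ : singly_hit K = [set F | closure F `&` K !=set0] `&`
   ~` \bigcup_ij (if `[<cball ij.1 `&` cball ij.2 = set0>] then
     [set F | closure F `&` (K `&` cball ij.1) !=set0] `&`
     [set F | closure F `&` (K `&` cball ij.2) !=set0] else set0)).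
  apply: measurableI; first exact: measurable_closure_hit.
  apply/measurableC/countable_bigcupT_measurable => [|s]; first exact: countableP.
  by case: asboolP => // _; apply: measurableI; exact: measurable_closure_hit.
rewrite predeqE => F; split=> [[v Fv]|[[v Fv] nF]].
  have [Fv1 Fv2] : (closure (F : set V) `&` K) v by rewrite Fv.
  split; first by exists v.
  move=> [[i j] _] /=; case: asboolP => // ij0 [[u [Fu [Ku iu]]] [w [Fw [Kw jw]]]].
  have uv : u = v by have : (closure (F : set V) `&` K) u by []; rewrite Fv.
  have wv : w = v by have : (closure (F : set V) `&` K) w by []; rewrite Fv.
  suff : (cball i `&` cball j) v by rewrite ij0.
  by split; [rewrite -uv|rewrite -wv].
have Fv' : (closure (F : set V) `&` K) v by [].
exists v; rewrite predeqE => w; split=> [[Fw Kw]|->//] /=.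
apply: contrapT => /eqP wv; apply: nF.
have e0 : 0 < `|w - v| / 2 by rewrite divr_gt0// normr_gt0 subr_eq0.
have [i [iw ie]] := cball_sub (nbhsx_ballx w _ e0).
have [j [jv je]] := cball_sub (nbhsx_ballx v _ e0).
exists (i, j) => //=; case: asboolP => [ij0|nij].
  have [Fv1 Kv] := Fv'.
  split; [exists w|exists v]; split=> //; split=> //; exact: rball_cball.
case: nij; rewrite -subset0 => z [/ie /ball_normP wz /je /ball_normP vz].
have := ler_normD (w - z) (z - v); rewrite addrA subrK (distrC z v); lra.
Qed.

Lemma pick_pointE (K : set V) (F : hit_space) v :
  closure (F : set V) `&` K = [set v] -> pick_point K F = v.
Proof.
move=> Fv; rewrite /pick_point; case: xgetP => [w _ /= Fw|/(_ v)//].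
by have : [set v] w by rewrite -Fv Fw.
Qed.

Lemma measurable_pick_point (K : set V) : compact K ->
  measurable_fun setT (pick_point K : hit_space -> borel V).
Proof.
move=> cK; apply: (@measurability _ _ hit_space (borel V) setT _ (@open V)) => //.
move=> _ [U oU <-]; rewrite setTI.
(* Where the point is unique, lying in [U] means hitting a closed rational ball inside [U];
   elsewhere the value is the default 0. *)
have -> : pick_point K @^-1` U = (singly_hit K `&`
    \bigcup_(i in [set i | cball i `<=` U]) [set F | closure (F : set V) `&` (K `&` cball i) !=set0])
    `|` (if `[<U 0>] then ~` singly_hit K else set0).
  rewrite predeqE => F; have [sF|nF] := pselect (singly_hit K F).
    have [v Fv] := sF; have [Fv1 Fv2] : (closure (F : set V) `&` K) v by rewrite Fv.
    rewrite /preimage /= (pick_pointE Fv); split=> [|[[_ [i iU [w [Fw [Kw /iU]]]]]|]].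
    - rewrite [X in X v](open_bigcup_cball oU) => -[i iU iv]; left; split=> //.
      by exists i => //; exists v.
    - have : (closure (F : set V) `&` K) w by [].
      by rewrite Fv => <-.
    - by case: asboolP.
  rewrite /preimage /= /pick_point xgetPN; last by move=> v Fv; apply: nF; exists v.
  split=> [U0|[[]//|]]; last by case: asboolP.
  by right; case: asboolP.
apply: measurableU; last first.
  by case: asboolP => // _; apply: measurableC; exact: measurable_singly_hit.
apply: measurableI; first exact: measurable_singly_hit.
rewrite bigcup_mkcond; apply: countable_bigcupT_measurable => [|i]; first exact: countableP.
case: ifPn => // _; apply: measurable_closure_hit.
by apply: compact_closedI => //; apply: compact_closed; [exact: norm_hausdorff|exact: cball_compact].
Qed.

End CompactHits.

(** * Borel maps into R^d and their coordinates *)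

Section BorelFunctions.
Variable R : realType.

Lemma continuous_measurable_borel (G H : topologicalZmodType) (f : G -> H) :
  continuous f -> measurable_fun setT (f : borel G -> borel H).
Proof.
move=> /continuousP cf; apply: (@measurability _ _ (borel G) (borel H) setT _ (@open H)) => //.
by move=> _ [U oU <-]; rewrite setTI; apply: sub_sigma_algebra; exact: cf.
Qed.

Lemma continuous_measurable_borelR (G : topologicalZmodType) (f : G -> R) :
  continuous f -> measurable_fun setT (f : borel G -> R).
Proof.
move=> /continuousP cf; apply: (measurability _ (RGenOpens.measurableE R)).
move=> _ [_ [a [b ->] <-]]; rewrite setTI; apply: sub_sigma_algebra.
exact/cf/interval_open.
Qed.

Lemma measurable_fun_rV d disp (T : measurableType disp) (f : T -> 'rV[R]_d) :
  (forall j, measurable_fun setT (fun x => f x 0 j)) ->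
  measurable_fun setT (f : T -> borel 'rV[R]_d).
Proof.
move=> mf; apply: (@measurability _ _ T (borel _) setT _ (@open 'rV[R]_d)) => //.
(* The norm is the maximum norm, so closed balls are defined coordinatewise. The sign condition
   matters for d = 0, where the coordinate condition is vacuous although a ball of negative radius
   is empty. *)
move=> _ [U oU <-]; rewrite setTI {1}(_ : U = \bigcup_(i in [set i | @cball R d i `<=` U])
    [set v | 0 <= ratr i.2 :> R /\ forall j, `|rvec R i.1 0 j - v 0 j| <= ratr i.2]).
  rewrite preimage_bigcup bigcup_mkcond.
  apply: countable_bigcupT_measurable => [|i]; first exact: countableP.
  case: ifPn => // _; rewrite (_ : _ @^-1` _ = [set x | 0 <= ratr i.2 :> R] `&`
    \bigcap_j [set x | `|rvec R i.1 0 j - f x 0 j| <= ratr i.2]).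
    apply: measurableI.
      by have [?|?] := pselect (0 <= ratr i.2 :> R);
        [rewrite (_ : mkset _ = setT) ?predeqE|rewrite (_ : mkset _ = set0) ?predeqE].
    apply: fin_bigcap_measurable => // j _.
    have mg : measurable_fun setT (fun x => `|rvec R i.1 0 j - f x 0 j|).
      by apply: measurableT_comp => //; apply: measurable_funB.
    have := mg measurableT `]-oo, (ratr i.2)]%classic (measurable_itv _).
    by rewrite setTI; congr measurable; rewrite predeqE => x /=; rewrite in_itv.
  by rewrite predeqE => x; split=> [[? H]|[? H]]; split=> // j; [move=> _|]; exact: H.
rewrite {1}(open_bigcup_cball oU); apply: eq_bigcupr => i _.
rewrite predeqE => v; split=> [iv|[i0 iv]].
  split; first exact: le_trans iv.
  move=> j; apply: le_trans iv; apply: le_trans (coord_norm_le _ j).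
  by rewrite !mxE.
rewrite /cball /= [leLHS]/Num.Def.normr /= mx_normrE; apply/bigmax_leP; split=> //.
by move=> [k j] _ /=; rewrite ord1 !mxE; have := iv j; rewrite mxE.
Qed.

Lemma measurable_coord d disp (T : measurableType disp) (f : T -> 'rV[R]_d) j :
  measurable_fun setT (f : T -> borel 'rV[R]_d) ->
  measurable_fun setT (fun x => f x 0 j).
Proof.
move=> mf; apply: (@measurableT_comp _ _ _ _ (borel 'rV[R]_d) _ (fun v : 'rV[R]_d => v 0 j)) => //.
by apply: continuous_measurable_borelR; exact: coord_continuous.
Qed.

End BorelFunctions.

(** * The stabilizer as a measurable map into closed subgroups *)

Section StabilizerMap.
Variables (R : realType) (d : nat) (disp : measure_display).
Variables (X : measurableType disp) (flow : X -> 'rV[R]_d -> X).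
Notation V := 'rV[R]_d.
Hypothesis sX : standard_borel R X.
Hypothesis Hflow : borel_action setT flow.

Lemma stab_Sgr x : Sgr (stab flow x).
Proof.
have [J [M [U [mM oU MU]]]] := stabC_bigcup sX Hflow.
split; first last.
- by move=> u v; rewrite /stab /= => xu xv; rewrite flowD// xu -{1}xv -flowD// subrr flow0.
- by rewrite /stab /= flow0.
rewrite -openC (_ : ~` _ = \bigcup_(j in [set j | M j x]) U j).
  by apply: bigcup_open => j _; exact: oU.
by rewrite predeqE => h; split=> [/MU[j Mj Uj]|[j Mj Uj]]; [exists j|apply/MU; exists j].
Qed.

(** This is commutativity of R^d. It makes the strata invariant and keeps vectors chosen from the
    stabilizer constant along orbits. *)
Lemma stab_flow x v : stab flow (flow x v) = stab flow x.
Proof.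
have K y : flow (flow y v) (- v) = y by rewrite -flowD// subrr flow0.
rewrite predeqE => h; rewrite /stab /= -flowD// addrC flowD//; split=> [|->//].
by move=> /(congr1 (flow^~ (- v))); rewrite !K.
Qed.

Lemma measurable_stab : measurable_fun setT (stab flow : X -> hit_space R d).
Proof.
have [J [M [U [mM oU MU]]]] := stabC_bigcup sX Hflow.
apply: (@measurability _ _ X (hit_space R d) setT _ (@hits R d)) => //.
move=> _ [_ [W oW <-] <-]; rewrite setTI.
rewrite (_ : _ @^-1` _ = \bigcup_(i in [set i | @cball R d i `<=` W])
    [set x | stab flow x `&` @cball R d i !=set0]).
  rewrite bigcup_mkcond; apply: countable_bigcupT_measurable => [|i]; first exact: countableP.
  case: ifPn => // _; apply: (measurable_compact_hit mM oU MU).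
  exact: cball_compact.
rewrite predeqE => x; split=> [[v [xv]]|[i iW [v [xv /iW Wv]]]]; last by exists v.
by rewrite {1}(open_bigcup_cball oW) => -[i iW iv]; exists i => //; exists v.
Qed.

End StabilizerMap.

(** * From the hit sigma-algebra to the Effros structure *)

Section EffrosTransfer.
Variables (R : realType) (d : nat).
Notation V := 'rV[R]_d.

Lemma hit_space_effros (A : set (hit_space R d)) : measurable A ->
  effros (A `&` [set F : set V | closed F]).
Proof.
move: A; apply: (@smallest_sub _ _ _ [set A | effros (A `&` [set F : set V | closed F])]).
  split=> [|A eA|F eF] /=.
  - by rewrite set0I; exact: sigma_algebra0.
  - rewrite setTD (_ : _ `&` _ = [set F : set V | closed F] `\`
        (A `&` [set F : set V | closed F])); first exact: sigma_algebraCD.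
    rewrite predeqE => F; split=> [[nA cF]|[cF nA]]; split=> //; first by case.
    by move=> AF; apply: nA.
  - by rewrite setI_bigcupl; exact: sigma_algebra_bigcup.
move=> _ [U oU <-] /=; apply: sub_sigma_algebra; exists U => //.
by rewrite predeqE => F /=; split=> -[].
Qed.

Lemma measurable_effros_borel_on (S : set (set V)) (f : set V -> V) :
  S `<=` [set F : set V | closed F] ->
  measurable_fun setT (f : hit_space R d -> borel V) -> effros_borel_on S f.
Proof.
move=> SC mf B mB; exists (f @^-1` B `&` [set F : set V | closed F]).
  by apply: hit_space_effros; rewrite -[X in measurable X]setTI; exact: mf.
by rewrite predeqE => F; split=> [[SF fB]|[SF [fB _]]]; split=> //; split=> //; exact: SC.
Qed.

End EffrosTransfer.

(** * Continuity of matrix maps and row independence *)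

Section ContinuityLemmas.

Lemma cvg_mx_coord (T U : topologicalType) m n (F : set_system T) {FF : Filter F}
    (f : T -> 'M[U]_(m, n)) (M : 'M[U]_(m, n)) :
  (forall i j, (fun x => f x i j) @ F --> M i j) -> f @ F --> M.
Proof.
move=> fM A [P nP PA]; apply: (@filterS _ F FF [set x | forall i j, P i j (f x i j)]).
  by move=> x Px; exact: PA.
by apply: filter_forall => i; apply: filter_forall => j; exact: fM (nP i j).
Qed.

Lemma mulmxr_continuous (R : realType) m n (A : 'M[R]_(m, n)) :
  continuous (fun u : 'rV[R]_m => u *m A).
Proof.
move=> u; apply: (@cvg_mx_coord _ _ _ _ (nbhs u) (nbhs_filter u)) => i j.
have H s : (fun v : 'rV[R]_m => \sum_(k <- s) v i k * A k j) @ nbhs u -->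
    \sum_(k <- s) u i k * A k j.
  elim: s => [|k s IHs].
    rewrite big_nil (_ : (fun=> _) = cst 0); first exact: cvg_cst.
    by apply/funext => v; rewrite big_nil.
  rewrite big_cons (_ : (fun=> _) = (fun v : 'rV[R]_m => v i k * A k j) \+
    (fun v : 'rV[R]_m => \sum_(k <- s) v i k * A k j)).
    apply: (@cvgD R R^o _ (nbhs u)) => //; apply: (@cvgM R _ (nbhs u)); last exact: cvg_cst.
    exact: coord_continuous.
  by apply/funext => v; rewrite big_cons.
rewrite mxE (_ : (fun=> _) = (fun v : 'rV[R]_m => \sum_k v i k * A k j)) //.
by apply/funext => v; rewrite mxE.
Qed.

Lemma nbhs_int_mx q (z : 'rV[int]_q) : nbhs z [set z].
Proof.
exists (fun i j => [set z i j]); first by move=> i j; exact: discrete_set1.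
by move=> w wz; apply/matrixP => i j; exact: (wz i j).
Qed.

End ContinuityLemmas.

Lemma row_free_ker (F : fieldType) m n (A : 'M[F]_(m, n)) :
  (forall u : 'rV_m, u *m A = 0 -> u = 0) -> row_free A.
Proof.
move=> H; rewrite -kermx_eq0 -submx0; apply/row_subP => i.
by rewrite (H (row i (kermx A))) ?sub0mx//; apply/sub_kermxP; exact: row_sub.
Qed.

Lemma row_free_col_mxl (F : fieldType) m p n (A : 'M[F]_(m, n)) (B : 'M[F]_(p, n)) :
  row_free (col_mx A B) -> row_free A.
Proof.
move=> AB; apply: row_free_ker => u uA.
have : row_mx u (0 : 'rV_p) *m col_mx A B = row_mx 0 0 *m col_mx A B.
  by rewrite !mul_row_col uA !mul0mx.
by move/(row_free_inj AB)/eq_row_mx => [].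
Qed.

(** * Linear normal form of a closed subgroup and its uniqueness *)

Section SplitSubgroups.
Variables (R : realType) (d : nat).
Notation V := 'rV[R]_d.

Definition intmx q (z : 'rV[int]_q) : 'rV[R]_q := map_mx intr z.

Lemma intmxB q (z w : 'rV[int]_q) : intmx (z - w) = intmx z - intmx w.
Proof. by apply/rowP => j; rewrite !mxE rmorphB. Qed.

Lemma intmxD q (z w : 'rV[int]_q) : intmx (z + w) = intmx z + intmx w.
Proof. by apply/rowP => j; rewrite !mxE rmorphD. Qed.

Lemma intmx_inj q : injective (@intmx q).
Proof. by move=> z w /rowP zw; apply/rowP => j; have := zw j; rewrite !mxE => /intr_inj. Qed.

Lemma intmx_delta q j : intmx (delta_mx 0 j : 'rV[int]_q) = delta_mx 0 j.
Proof. exact: map_delta_mx. Qed.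

Definition spans p q (H : set V) (P : 'M[R]_(p, d)) (Q : 'M[R]_(q, d)) :=
  forall v, H v <-> exists (u : 'rV[R]_p) (z : 'rV[int]_q), v = u *m P + intmx z *m Q.

(** The linear counterpart of [top_group_iso]: independence of all rows over R takes over the role
    of continuity of the inverse. *)
Definition split_sgr p q (H : set V) := exists (P : 'M[R]_(p, d)) (Q : 'M[R]_(q, d)),
  row_free (col_mx P Q) /\ spans H P Q.

Lemma split_sgr_iso p q (H : set V) : split_sgr p q H -> top_group_iso p q H.
Proof.
move=> [P [Q [PQ HPQ]]]; pose N := pinvmx (col_mx P Q).
have PQN (u : 'rV_p) (w : 'rV_q) : (u *m P + w *m Q) *m N = row_mx u w.
  by rewrite -mul_row_col -mulmxA mulmxVp// mulmx1.
(* On [H] the last q coordinates are already integers; the floor only makes the map total. *)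
pose psi v := (lsubmx (v *m N), map_mx Num.floor (rsubmx (v *m N)) : 'rV[int]_q).
exists (fun x => x.1 *m P + intmx x.2 *m Q), psi; split.
- by move=> [u1 z1] [u2 z2] /=; rewrite intmxD !mulmxDl addrACA.
- rewrite predeqE => v; split=> [[[u z] _ <-]|/HPQ[u [z ->]]]; last by exists (u, z).
  by apply/HPQ; exists u, z.
- move=> [u z]; rewrite /psi PQN row_mxKl row_mxKr; congr (_, _).
  by apply/rowP => j; rewrite !mxE intrKfloor.
- move=> [u z]; apply: (@cvgD R V); first by apply: (@cvg_comp _ _ _ fst (fun u => u *m P) _ (nbhs u));
    [exact: cvg_fst|exact: mulmxr_continuous].
  move=> A nA; exists (setT, [set z]); first by split=> /=; [exact: filterT|exact: nbhs_int_mx].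
  by move=> [u' z'] [_ /= ->]; exact: nbhs_singleton.
- apply: (@subspace_continuousP _ H _ psi).2 => v Hv.
  have [u [z vE]] := (HPQ v).1 Hv.
  (* Integer coordinates are locally constant on [H], as distinct integers are at distance at least
     1. *)
  have psi2 : \forall w \near within H (nbhs v), (psi w).2 = (psi v).2.
    have cN := @mulmxr_continuous R _ _ N v.
    apply: (@filterS _ (nbhs v) (nbhs_filter v) ((fun u => u *m N) @^-1` ball (v *m N) 1));
      last exact: (cN _ (nbhsx_ballx _ _ ltr01)).
    move=> w /ball_normP/= vw Hw.
    have [u' [z' wE]] := (HPQ w).1 Hw.
    move: vw; rewrite /psi vE wE !PQN !row_mxKr opp_row_mx add_row_mx -intmxB => zz.
    suff -> : z = z' by [].
    apply/rowP => j; apply/eqP; rewrite -subr_eq0; apply/eqP.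
    have := le_lt_trans (coord_norm_le _ (rshift p j)) zz.
    rewrite row_mxEr !mxE -intr_norm -[1]/(1%:~R) ltr_int.
    by case: (_ - _) => [[]|].
  move=> A [[A1 A2] /= [nA1 nA2] sA].
  have c1 : lsubmx (w *m N) @[w --> within H (nbhs v)] --> lsubmx (v *m N).
    apply: cvg_within_filter; rewrite -mulmx_lsub.
    by under eq_fun do rewrite -mulmx_lsub; exact: mulmxr_continuous.
  suff : within H (nbhs v) (psi @^-1` A) by [].
  have FF : Filter (within H (nbhs v)) := within_filter _ (nbhs_filter v).
  move: (c1 _ nA1) psi2; apply: (@filterS2 V _ FF) => w A1w E; apply: sA; split=> //=.
  by have /= -> := E; exact: nbhs_singleton.
Qed.

(** Additivity gives homogeneity over the rationals, and the scalars that satisfy it form a closed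
    set. *)
Lemma additive_continuous_linear p (f : 'rV[R]_p -> V) :
  (forall u v, f (u + v) = f u + f v) -> continuous f ->
  forall (t : R) u, f (t *: u) = t *: f u.
Proof.
move=> fD cf t u.
have f0 : f 0 = 0 by apply: (addrI (f 0)); rewrite -fD !addr0.
have fN v : f (- v) = - f v by apply: (addrI (f v)); rewrite -fD !subrr.
have fMn n v : f (n%:R *: v) = n%:R *: f v.
  elim: n => [|n IHn]; first by rewrite !scale0r.
  by rewrite -[n.+1]addn1 natrD !scalerDl !scale1r fD IHn.
have fMz (n : int) v : f (n%:~R *: v) = n%:~R *: f v.
  by case: n => n; rewrite ?NegzE ?mulrNz ?scaleNr ?fN -?pmulrn fMn.
pose S := [set s : R | f (s *: u) - s *: f u = 0].
suff : S t by move/eqP; rewrite subr_eq0 => /eqP.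
have Srat (a : rat) : S (ratr a).
  apply/eqP; rewrite subr_eq0; apply/eqP.
  have d0 : (denq a)%:~R != 0 :> R by rewrite intr_eq0 denq_neq0.
  apply: (scalerI d0); rewrite -fMz !scalerA /ratr mulrC divfK// fMz.
have cg : continuous (fun s : R => f (s *: u) - s *: f u).
  have cs k (w : 'rV[R]_k) : continuous (fun s : R => s *: w).
    by move=> s; apply: (@cvgZr_tmp R _ _ (nbhs s)).
  move=> s; apply: (@cvgB R V _ (nbhs s)); last exact: cs.
  by apply: (@continuous_comp _ _ _ (fun s : R => s *: u) f); [exact: cs|exact: cf].
have cS : closed S.
  change (closed ((fun s : R => f (s *: u) - s *: f u) @^-1` [set 0])).
  apply: preimage_closed; first by move=> s _; exact: cg.
  exact/accessible_closed_set1/hausdorff_accessible/norm_hausdorff.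
apply: cS => B; rewrite nbhsE => -[W [oW Wt] WB].
have [b [Wb [a _ ab]]] := @dense_rat R W (ex_intro _ t Wt) oW; rewrite -ab in Wb.
by exists (ratr a); split; [exact: Srat|exact: WB].
Qed.

Lemma spans_mulr_line p q (H : set V) (P : 'M[R]_(p, d)) (Q : 'M[R]_(q, d)) :
  row_free (col_mx P Q) -> spans H P Q ->
  forall v, (forall t : R, H (t *: v)) -> (v <= P)%MS.
Proof.
move=> PQ HPQ v Hv; pose N := pinvmx (col_mx P Q).
have PQN (u : 'rV_p) (w : 'rV_q) : (u *m P + w *m Q) *m N = row_mx u w.
  by rewrite -mul_row_col -mulmxA mulmxVp// mulmx1.
have [u [z vE]] : exists u z, v = u *m P + intmx z *m Q.
  by apply/HPQ; rewrite -[v]scale1r.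
suff z0 : z = 0.
  rewrite vE z0 (_ : intmx 0 = 0) ?mul0mx ?addr0 ?submxMl//.
  by apply/rowP => j; rewrite !mxE.
apply/rowP => j; rewrite mxE; apply/eqP; apply: contraT => zj.
have z0 : (z 0 j)%:~R != 0 :> R by rewrite intr_eq0.
(* This multiple of v would be a point of [H] whose j-th integer coordinate is 1/2. *)
have [u' [z' vE']] := (HPQ _).1 (Hv (2 * (z 0 j)%:~R)^-1).
have : rsubmx (((2 * (z 0 j)%:~R)^-1 *: v) *m N) 0 j = rsubmx ((u' *m P + intmx z' *m Q) *m N) 0 j.
  by rewrite vE'.
rewrite -scalemxAl vE !PQN scale_row_mx !row_mxKr !mxE invfM -mulrA mulVf// mulr1 => half.
have : (1 : int)%:~R = (2 * z' 0 j)%:~R :> R by rewrite intrM -half mulfV.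
by move/intr_inj; lia.
Qed.

(** By linearity the isomorphism is given by matrices [P] and [Q]. The spaces of [P] and [P']
    coincide, whence p = p'. Modulo that space [Q] and [Q'] are integral combinations of each other,
    and the two integer matrices are mutually inverse, whence q = q'. *)
Lemma iso_split_unique p q p' q' (H : set V) :
  top_group_iso p q H -> split_sgr p' q' H -> p = p' /\ q = q'.
Proof.
move=> [phi [psi [phiD phiH psiK cphi cpsi]]] [P' [Q' [PQ' HPQ']]].
have Hphi x : H (phi x) by rewrite -phiH; exists x.
have phi0 : phi 0 = 0 by apply: (addrI (phi 0)); rewrite -phiD !addr0.
have phiN x : phi (- x) = - phi x by apply: (addrI (phi x)); rewrite -phiD !subrr.
have phi_inj : injective phi := can_inj psiK.
have phi1Z (t : R) u : phi (t *: u, 0) = t *: phi (u, 0).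
  apply: (@additive_continuous_linear _ (fun u => phi (u, 0))) => [v w|v].
    by rewrite -phiD; congr (phi (_, _)); rewrite addr0.
  apply: (@continuous_comp _ _ _ (fun u : 'rV[R]_p => (u, 0 : 'rV[int]_q)) phi); last exact: cphi.
  move=> A [[A1 A2] /= [nA1 nA2] sA]; apply: (@filterS _ (nbhs v) (nbhs_filter v) A1) => // w A1w.
  by apply: sA; split=> //=; exact: nbhs_singleton.
have phi1D u v : phi (u + v, 0) = phi (u, 0) + phi (v, 0).
  by rewrite -phiD; congr (phi (_, _)); rewrite addr0.
have phi2D u v : phi (0, u + v) = phi (0, u) + phi (0, v).
  by rewrite -phiD; congr (phi (_, _)); rewrite addr0.
pose P := \matrix_i phi (delta_mx 0 i : 'rV[R]_p, 0).
pose Q := \matrix_i phi (0, delta_mx 0 i : 'rV[int]_q).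
have phiP u : phi (u, 0) = u *m P.
  rewrite mulmx_sum_row {1}(row_sum_delta u).
  rewrite (big_morph (fun u : 'rV[R]_p => phi (u, 0)) phi1D phi0).
  by apply: eq_bigr => j _; rewrite phi1Z rowK.
have phiMz (k : int) x : phi (0, k *: x) = k%:~R *: phi (0, x).
  have phiMn n : phi (0, n%:Z *: x) = n%:R *: phi (0, x).
    elim: n => [|n IHn]; first by rewrite !scale0r -phi0.
    rewrite -[n.+1]addn1 natrD PoszD !scalerDl !scale1r -IHn -phiD.
    by congr (phi (_, _)); rewrite addr0.
  case: k => n; first by rewrite phiMn.
  rewrite NegzE mulrNz !scaleNr -phiMn -phiN.
  by congr (phi (_, _)); rewrite oppr0.
have phiQ z : phi (0, z) = intmx z *m Q.
  rewrite mulmx_sum_row {1}(row_sum_delta z).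
  rewrite (big_morph (fun z : 'rV[int]_q => phi (0, z)) phi2D phi0).
  by apply: eq_bigr => j _; rewrite phiMz rowK mxE.
have phiE u z : phi (u, z) = u *m P + intmx z *m Q.
  by rewrite -phiP -phiQ -phiD; congr (phi (_, _)); rewrite ?addr0 ?add0r.
have HPQ : spans H P Q.
  move=> v; split=> [|[u [z ->]]]; last by rewrite -phiE.
  by rewrite -phiH => -[[u z] _ <-]; exists u, z.
have sPP' : (P <= P')%MS.
  apply/row_subP => i; apply: (spans_mulr_line PQ' HPQ') => t.
  by rewrite rowK -phi1Z; exact: Hphi.
have H0 : H 0 by rewrite -phi0.
have sP'P : (P' <= P)%MS.
  apply/row_subP => i.
  have Hi (t : R) : H (t *: row i P').
    apply/HPQ'; exists (t *: delta_mx 0 i), 0; rewrite -scalemxAl -rowE.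
    by rewrite (_ : intmx 0 = 0) ?mul0mx ?addr0//; apply/rowP => j; rewrite !mxE.
  have /subspace_continuousP/(_ _ H0) := cpsi.
  have psi0 : psi 0 = 0 by rewrite -phi0 psiK.
  have nb : nbhs (psi 0) [set x | x.2 = 0].
    rewrite psi0; exists (setT, [set 0]); last by move=> [u z] [_].
    by split; [exact: filterT|exact: nbhs_int_mx].
  move=> /(_ _ nb); rewrite /= => /nbhs_ballP[e /= e0 He].
  have [n ne] : exists n : nat, `|n.+1%:R^-1 *: row i P'| < e.
    have a0 : 0 < e / (`|row i P'| + 1) by rewrite divr_gt0// ltr_wpDl.
    have [k _ kd] := near_infty_natSinv_lt (PosNum a0); exists k.
    have := kd k (leqnn k); rewrite /= ltr_pdivlMr ?ltr_wpDl// normrZ ger0_norm// => /(le_lt_trans _); apply.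
    by rewrite ler_wpM2l// lerDl.
  have nball : ball (0 : V) e (n.+1%:R^-1 *: row i P') by apply/ball_normP; rewrite sub0r normrN.
  have := He _ nball (Hi _).
  have := Hi n.+1%:R^-1; rewrite -phiH => -[[u z] _ uz]. rewrite /from_subspace -uz /= psiK /= => z0.
  have -> : row i P' = n.+1%:R *: (u *m P).
    by rewrite -phiP -z0 uz scalerA mulfV ?scale1r.
  by rewrite scalemx_sub// submxMl.
have fP : row_free P.
  apply: row_free_ker => u uP; have /phi_inj : phi (u, 0) = phi 0 by rewrite phiP uP phi0.
  by case.
have pp' : p = p'.
  have := fP; have := row_free_col_mxl PQ'; rewrite /row_free => /eqP <- /eqP <-.
  by apply/eqmx_rank/andP.
split=> //.
have rowQ' j : H (row j Q').
  apply/HPQ'; exists 0, (delta_mx 0 j).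
  by rewrite mul0mx add0r intmx_delta rowE.
have rowQ j : H (row j Q) by rewrite rowK.
pose A j := sval (cid ((HPQ _).1 (rowQ' j))).
pose Z j := sval (cid (svalP (cid ((HPQ _).1 (rowQ' j))))).
have AZ j : row j Q' = A j *m P + intmx (Z j) *m Q := svalP (cid (svalP (cid ((HPQ _).1 (rowQ' j))))).
pose B j := sval (cid ((HPQ' _).1 (rowQ j))).
pose W j := sval (cid (svalP (cid ((HPQ' _).1 (rowQ j))))).
have BW j : row j Q = B j *m P' + intmx (W j) *m Q' := svalP (cid (svalP (cid ((HPQ' _).1 (rowQ j))))).
pose Zm : 'M[int]_(q', q) := \matrix_j Z j; pose Wm : 'M[int]_(q, q') := \matrix_j W j.
have Q'E : Q' = (\matrix_j A j) *m P + map_mx intr Zm *m Q.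
  by apply/row_matrixP => j; rewrite AZ linearD /= !row_mul rowK -map_row rowK.
have QE : Q = (\matrix_j B j) *m P' + map_mx intr Wm *m Q'.
  by apply/row_matrixP => j; rewrite BW linearD /= !row_mul rowK -map_row rowK.
have [C PC] := submxP sPP'; have [C' P'C'] := submxP sP'P.
(* Here integer coordinates are unique because [phi] is injective; for the opposite product below,
   because [P'] and [Q'] are independent. *)
have WZ : Wm *m Zm = 1%:M.
  apply/row_matrixP => j; rewrite row1.
  have : phi (row j ((\matrix_j B j) *m C' + map_mx intr Wm *m \matrix_j A j), row j (Wm *m Zm))
       = phi (0, delta_mx 0 j).
    rewrite phiE /intmx map_row map_mxM -row_mul -row_mul -raddfD /=.
    rewrite mulmxDl -!mulmxA -P'C' -addrA -mulmxDr -Q'E -QE.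
    by rewrite /Q rowK.
  by move/phi_inj => [].
have ZW : Zm *m Wm = 1%:M.
  apply/row_matrixP => j; rewrite row1.
  have : row_mx (row j ((\matrix_j A j) *m C + map_mx intr Zm *m \matrix_j B j)) (intmx (row j (Zm *m Wm))) *m col_mx P' Q'
       = row_mx 0 (intmx (delta_mx 0 j)) *m col_mx P' Q'.
    rewrite !mul_row_col /intmx map_row map_mxM -row_mul -row_mul -raddfD /=.
    rewrite mulmxDl -!mulmxA -PC -addrA -mulmxDr -QE -Q'E mul0mx add0r.
    by rewrite map_delta_mx rowE.
  by move/(row_free_inj PQ')/eq_row_mx => [_ /intmx_inj].
by apply/eqP; rewrite eqn_leq; apply/andP; split; [exact: mulmx1_min WZ|exact: mulmx1_min ZW].
Qed.

End SplitSubgroups.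

(** * Discrete subgroups and subgroups containing a line *)

Section ClosedSubgroups.
Variables (R : realType) (d : nat).
Notation V := 'rV[R]_d.
Implicit Types (H : set V).

Definition separated H :=
  exists2 e : R, 0 < e & forall v, H v -> v != 0 -> e <= `|v|.

Definition zcoord p (c : 'I_p -> 'I_d) : set V := [set v | colsub c v = 0].

Lemma SgrB H u v : Sgr H -> H u -> H v -> H (u - v).
Proof. by case=> _ _; apply. Qed.

Lemma SgrD H u v : Sgr H -> H u -> H v -> H (u + v).
Proof.
move=> SH Hu Hv; have H0 : H 0 by case: SH.
by rewrite -[v]opprK -[- v]sub0r; apply: SgrB => //; exact: SgrB.
Qed.

Lemma Sgr_intr H v (k : int) : Sgr H -> H v -> H (k%:~R *: v).
Proof.
move=> SH Hv; have Hn n : H (n%:R *: v).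
  elim: n => [|n IHn]; first by rewrite scale0r; case: SH.
  by rewrite -[n.+1]addn1 natrD scalerDl scale1r; exact: SgrD.
case: k => n; first exact: Hn.
have H0 : H 0 by case: SH.
by rewrite NegzE mulrNz scaleNr -sub0r; exact: (SgrB SH H0 (Hn n.+1)).
Qed.

Lemma Sgr_intmx H q (z : 'rV[int]_q) (Q : 'M[R]_(q, d)) : Sgr H ->
  (forall i, H (row i Q)) -> H (intmx R z *m Q).
Proof.
move=> SH HQ; rewrite mulmx_sum_row; elim: (index_enum _) => [|i s IHs].
  by rewrite big_nil; case: SH.
by rewrite big_cons; apply: SgrD => //; rewrite mxE; exact: Sgr_intr.
Qed.

Lemma Sgr_zcoord H p (c : 'I_p -> 'I_d) : Sgr H -> Sgr (H `&` zcoord c).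
Proof.
move=> [cH H0 HB]; split.
- apply: closedI => //; rewrite (_ : zcoord c = \bigcap_i [set v : V | v 0 (c i) = 0]).
    apply: closed_bigI => i _.
    change (closed ((fun v : V => v 0 (c i)) @^-1` [set 0])).
    apply: preimage_closed; first by move=> v _; exact: coord_continuous.
    exact/accessible_closed_set1/hausdorff_accessible/Rhausdorff.
  rewrite predeqE => v; split=> [/rowP cv i _|cv].
    by have := cv i; rewrite !mxE.
  by apply/rowP => i; rewrite !mxE; exact: cv.
- by split=> //; apply/rowP => i; rewrite !mxE.
- move=> u v [Hu cu] [Hv cv]; split; first exact: HB.
  by rewrite /zcoord /= linearB /= cu cv subrr.
Qed.

(* Multiples of shorter and shorter vectors fill up a line. *)
Lemma closed_subgroup_line H : Sgr H -> ~ separated H ->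
  exists2 w, w != 0 & forall t : R, H (t *: w).
Proof.
move=> SH nsep; have short n : exists v, [/\ H v, v != 0 & `|v| < n.+1%:R^-1].
  apply: contrapT => nv; apply: nsep; exists n.+1%:R^-1 => // v Hv v0.
  by rewrite leNgt; apply/negP => vn; apply: nv; exists v.
pose v n := sval (cid (short n)).
have vP n : [/\ H (v n), v n != 0 & `|v n| < n.+1%:R^-1] := svalP (cid (short n)).
have vn0 n : `|v n| != 0 by have [_] := vP n; rewrite normr_eq0.
pose u n := `|v n|^-1 *: v n.
have cS : compact [set x : V | `|x| = 1].
  apply: bounded_closed_compact.
    by exists 1; split; [exact: num_real|move=> M M1 x /= ->; exact: ltW].
  change (closed ((fun x : V => `|x|) @^-1` [set 1])).
  apply: preimage_closed; first by move=> x _; exact: norm_continuous.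
  exact/accessible_closed_set1/hausdorff_accessible/Rhausdorff.
have uS : (u @ \oo) [set x : V | `|x| = 1].
  by exists 0%N => // n _; rewrite /= normrZ ger0_norm ?invr_ge0// mulVf.
have [w [/= w1 clw]] := cS _ _ uS.
exists w; first by rewrite -normr_eq0 w1 oner_eq0.
move=> t; case: (SH) => + _ _; apply => B /nbhs_ballP[e /= e0 eB].
have e2 : 0 < e / 2 by rewrite divr_gt0.
have t1 : 0 < `|t| + 1 by rewrite ltr_wpDl.
(* Half of e pays for replacing w by [u n], an error multiplied by |t|; the other half pays for
   rounding t to a multiple of the length of [v n]. *)
have et : 0 < e / 2 / (`|t| + 1) by rewrite divr_gt0.
have [N _ HN] := near_infty_natSinv_lt (PosNum e2).
have FN : (u @ \oo) [set x | exists2 n, (N <= n)%N & x = u n].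
  by exists N => // n Nn; exists n.
have [_ [[n Nn ->] /ball_normP wu]] := clw _ _ FN (nbhsx_ballx w _ et).
have [Hv _ vn] := vP n.
pose k := Num.floor (t / `|v n|).
exists (k%:~R *: v n); split; first exact: Sgr_intr.
apply/eB/ball_normP => /=.
have -> : t *: w - k%:~R *: v n = t *: (w - u n) + (t / `|v n| - k%:~R) *: v n.
  by rewrite /u scalerBr scalerBl scalerA addrA subrK.
have h1 : `|t *: (w - u n)| <= e / 2.
  rewrite normrZ; apply: (@le_trans _ _ (`|t| * (e / 2 / (`|t| + 1)))).
    by rewrite ler_wpM2l// ltW.
  by rewrite [leLHS]mulrA ler_pdivrMr// mulrC ler_wpM2l ?(ltW e2)// lerDl.
have h2 : `|(t / `|v n| - k%:~R) *: v n| < e / 2.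
  have := HN n Nn; rewrite /= => /(lt_trans vn); apply: le_lt_trans.
  rewrite normrZ ler_piMl// ger0_norm; first by have := floorD1_gt (t / `|v n|); rewrite intrD -/k; lra.
  by rewrite subr_ge0 floor_le.
by rewrite (le_lt_trans (ler_normD _ _))// (splitr e) ler_ltD.
Qed.

Lemma separated_line H w : separated H -> (forall t : R, H (t *: w)) -> w = 0.
Proof.
move=> [e e0 He] Hw; apply/eqP; apply: contraT => w0.
have nw : 0 < `|w| by rewrite normr_gt0.
have := He _ (Hw (e / 2 / `|w|)); rewrite scaler_eq0 negb_or w0 andbT.
have -> : e / 2 / `|w| != 0 by rewrite gt_eqF// !divr_gt0.
have tw0 : 0 <= e / 2 / `|w| by rewrite ltW// !divr_gt0.
rewrite normrZ (ger0_norm tw0) divfK ?gt_eqF// => /(_ isT); lra.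
Qed.

Lemma separated_closed H (S : set V) :
  (forall u v, H u -> H v -> H (u - v)) -> separated H -> S `<=` H -> closed S.
Proof.
move=> HB [e e0 He] SH w clw; have e2 : 0 < e / 2 by rewrite divr_gt0.
have [s [Ss /ball_normP ws]] := clw _ (nbhsx_ballx w _ e2).
suff -> : w = s by [].
apply/eqP; apply: contraT; rewrite -subr_eq0 => sw.
(* A point of [S] closer to w than s is different from s, yet differs from it by a vector of [H]
   shorter than e. *)
have sw2 : 0 < Num.min (e / 2) `|w - s| by rewrite lt_min e2 normr_gt0.
have [r [Sr /ball_normP]] := clw _ (nbhsx_ballx w _ sw2).
rewrite lt_min => /andP[wr wr2].
have [rs|rs] := eqVneq r s; first by rewrite rs ltxx in wr2.
have := He (r - s) (HB _ _ (SH _ Sr) (SH _ Ss)); rewrite subr_eq0 rs => /(_ isT).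
have := ler_normB (w - s) (w - r); rewrite opprB addrC addrA subrK; lra.
Qed.

(** One missed annulus of ratio 2 suffices: the least multiple of a short vector that reaches length
    r overshoots by less than r. Annuli are compact, so this test for discreteness is measurable in
    [H]. *)
Lemma separated_annulus H : Sgr H -> separated H <->
  exists n : nat, ~ exists v, H v /\ n.+1%:R^-1 <= `|v| <= 2 * n.+1%:R^-1.
Proof.
move=> SH; split=> [[e e0 He]|[n Hn]].
  have e2 : 0 < e / 2 by rewrite divr_gt0.
  have [n _ /(_ n (leqnn n))/= ne] := near_infty_natSinv_lt (PosNum e2).
  exists n => -[v [Hv /andP[v1 v2]]].
  have n0 : 0 < n.+1%:R^-1 :> R by rewrite invr_gt0.
  have /(He _ Hv) : v != 0 by rewrite -normr_gt0; exact: lt_le_trans v1.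
  by move: ne v1 v2 n0; set r := n.+1%:R^-1; lra.
have r0 : 0 < n.+1%:R^-1 :> R by rewrite invr_gt0.
set r := n.+1%:R^-1 in r0 Hn; exists r => // v Hv v0.
rewrite leNgt; apply/negP => vr; apply: Hn.
have v0' : 0 < `|v| by rewrite normr_gt0.
exists ((Num.ceil (r / `|v|))%:~R *: v); split; first exact: Sgr_intr.
have rv := @ceil_ge R (r / `|v|); have rv1 := @ceilB1_lt R (r / `|v|).
have rv0 : 0 < r / `|v| by rewrite divr_gt0.
rewrite normrZ ger0_norm; last exact: le_trans (ltW rv0) rv.
rewrite -ler_pdivrMr// rv /=.
have : (Num.ceil (r / `|v|))%:~R <= r / `|v| + 1 :> R.
  by move: rv1; rewrite intrB ltrBlDr => /ltW.
rewrite -(ler_pM2r v0') mulrDl divfK ?gt_eqF//; lra.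
Qed.

Lemma row_free_col_mxr p q (A : 'M[R]_(p, d)) (B : 'M[R]_(q, d)) :
  row_free (col_mx A B) -> row_free B.
Proof.
move=> AB; apply: row_free_ker => u uA.
have : row_mx (0 : 'rV[R]_p) u *m col_mx A B = row_mx 0 0 *m col_mx A B.
  by rewrite !mul_row_col uA !mul0mx.
by move/(row_free_inj AB)/eq_row_mx => [].
Qed.

End ClosedSubgroups.

(** * Lattice bases and the structure of closed subgroups *)

Section Structure.
Variables (R : realType) (d : nat).
Notation V := 'rV[R]_d.
Implicit Types (H : set V).
Local Notation intmx := (intmx R).

Lemma row_free_cons m (v : V) (A : 'M[R]_(m, d)) :
  row_free A -> ~~ (v <= A)%MS -> row_free (col_mx v A).
Proof.
move=> fA vA; apply: row_free_ker => u; rewrite -[u]hsubmxK mul_row_col => uA.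
have [u0|u0] := eqVneq (lsubmx u 0 0) 0.
  have l0 : lsubmx u = 0 by rewrite [LHS]mx11_scalar u0 raddf0.
  move: uA; rewrite l0 mul0mx add0r -(mul0mx _ A) => /(row_free_inj fA) ->.
  by rewrite row_mx0.
case/negP: vA; rewrite -(scalerK u0 v); apply: scalemx_sub.
move: uA; rewrite {1}[lsubmx u]mx11_scalar mul_scalar_mx => /eqP.
by rewrite addr_eq0 => /eqP ->; rewrite eqmx_opp submxMl.
Qed.

Lemma rows_cons H m (v : V) (A : 'M[R]_(m, d)) :
  H v -> (forall i, H (row i A)) -> forall i : 'I_(1 + m), H (row i (col_mx v A)).
Proof.
move=> Hv HA i; case: (@splitP 1 m i) => j ij.
  rewrite (_ : i = lshift m j); last exact: val_inj.
  by rewrite rowKu; have -> : row j v = v by apply/rowP => k; rewrite mxE ord1.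
rewrite (_ : i = rshift 1 j); last exact: val_inj.
by rewrite rowKd.
Qed.

(** Induction on the rank. The new basis vector has the least positive coordinate along the first
    row of [A]; division with remainder by that coordinate reduces any other vector to the span of
    the remaining rows. *)
Lemma discrete_basis_in H : Sgr H -> separated H ->
  forall m (A : 'M[R]_(m, d)), row_free A -> (forall i, H (row i A)) ->
  exists B : 'M[R]_(m, d), [/\ row_free B, (B :=: A)%MS, forall i, H (row i B) &
    forall v, H v -> (v <= A)%MS -> exists z, v = intmx z *m B].
Proof.
move=> SH sepH; have H0 : H 0 by case: SH.
elim=> [A fA HA|m IHm A0 fA0 HA0].
  exists A; split=> // v _; rewrite (flatmx0 A) => /submx0null ->.
  by exists 0; rewrite mulmx0.
pose A : 'M[R]_(1 + m, d) := A0; have fA : row_free A := fA0.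
have HA i : H (row i A) := HA0 i.
pose a := usubmx A; have AE : A = col_mx a (dsubmx A) by rewrite vsubmxK.
have fA' : row_free (dsubmx A) by apply: (@row_free_col_mxr R d 1 m a); rewrite -AE.
have Ha : H a.
  have -> : a = row (lshift m 0) A by apply/rowP => j; rewrite !mxE.
  exact: HA.
have [i|B' [fB' B'A HB' B'z]] := IHm (dsubmx A) fA'.
  have -> : row i (dsubmx A) = row (rshift 1 i) A by apply/rowP => j; rewrite !mxE.
  exact: HA.
pose M := col_mx a B'.
have MA : (M :=: A)%MS.
  rewrite AE; apply: eqmx_trans (addsmxE _ _).
  by apply: eqmx_trans (eqmx_sym (addsmxE _ _)) _; apply: adds_eqmx.
have fM : row_free M by rewrite /row_free MA.
pose N := pinvmx M.
have MN (t : 'rV[R]_1) (w : 'rV[R]_m) : (t *m a + w *m B') *m N = row_mx t w.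
  by rewrite -mul_row_col -mulmxA mulmxVp// mulmx1.
have NM v : (v <= A)%MS -> v = lsubmx (v *m N) *m a + rsubmx (v *m N) *m B'.
  by move=> vA; rewrite -mul_row_col hsubmxK mulmxKpV// MA.
(* The search is confined to a bounded set: [a] has first coordinate 1, and the other coordinates
   can be reduced modulo [B']. The strict inequality does not spoil closedness, since every subset
   of a separated group is closed. *)
pose K := [set v : V | H v /\ [/\ (v <= A)%MS, 0 < lsubmx (v *m N) 0 0 <= 1 &
  forall j, 0 <= rsubmx (v *m N) 0 j <= 1]].
pose cube := [set x : 'rV[R]_(1 + m) | forall i, `[0, 1]%classic (x ord0 i)].
have cK : compact K.
  have ccube : compact cube.
    by apply: (@rV_compact R _ (fun=> `[0, 1]%classic)) => i; exact: segment_compact.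
  have cMc : compact ((fun x : 'rV[R]_(1 + m) => x *m M) @` cube).
    apply: continuous_compact => //; apply: continuous_subspaceT.
    exact: mulmxr_continuous.
  apply: (subclosed_compact _ cMc).
    by apply: (separated_closed _ sepH) => [u v|v []//]; exact: SgrB.
  move=> v [Hv [vA /andP[v0 v1] vj]]; exists (v *m N); last by rewrite mulmxKpV// MA.
  move=> i; rewrite /= in_itv /= -[v *m N]hsubmxK; case: (splitP i) => j ij.
    rewrite (_ : i = lshift m j); last exact: val_inj.
    by rewrite row_mxEl (ord1 j) (ltW v0) v1.
  rewrite (_ : i = rshift 1 j); last exact: val_inj.
  by rewrite row_mxEr; exact: vj.
have Ka : K a.
  have aN : a *m N = row_mx 1%:M 0 by rewrite -MN mul1mx mul0mx addr0.
  split=> //; split; first by rewrite AE -addsmxE addsmxSl.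
    by rewrite aN row_mxKl mxE /= ltr01 lexx.
  by move=> j; rewrite aN row_mxKr mxE lexx ler01.
have cf : continuous (fun v : V => lsubmx (v *m N) 0 0).
  have -> : (fun v : V => lsubmx (v *m N) 0 0) =
      (fun x : 'rV[R]_1 => x 0 0) \o (fun v : V => v *m lsubmx N).
    by apply/funext => v /=; rewrite mulmx_lsub.
  by move=> v; apply: continuous_comp; [exact: mulmxr_continuous|exact: coord_continuous].
have [c Kc cmin] := EVT_min_rV (ex_intro _ a Ka) cK (continuous_subspaceT cf).
move: Kc; rewrite inE => -[Hc [cA /andP[c0 c1] cj]].
set t0 := lsubmx (c *m N) 0 0 in cmin c0 c1; set w0 := rsubmx (c *m N) in cj.
have cN : c *m N = row_mx t0%:M w0.
  by rewrite -[LHS]hsubmxK; congr (row_mx _ _); rewrite [LHS]mx11_scalar.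
pose B : 'M[R]_(1 + m, d) := col_mx c B'.
have BA : (B <= A)%MS.
  by rewrite col_mx_sub cA /= AE -addsmxE B'A addsmxSr.
have fB : row_free B.
  apply: row_free_ker => u; rewrite -[u]hsubmxK mul_row_col => uB.
  have : (lsubmx u *m c + rsubmx u *m B') *m N = 0 by rewrite uB mul0mx.
  have -> : (lsubmx u *m c + rsubmx u *m B') *m N =
     row_mx (t0 *: lsubmx u) (lsubmx u *m w0 + rsubmx u).
    rewrite mulmxDl -mulmxA cN -[rsubmx u *m B']add0r -(mul0mx _ a) MN mul_mx_row.
    by rewrite add_row_mx addr0 mul_mx_scalar.
  rewrite -row_mx0 => /eq_row_mx[/eqP]; rewrite scaler_eq0 gt_eqF//= => /eqP ->.
  by rewrite mul0mx add0r => ->.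
exists B; split=> //.
- apply/eqmxP; rewrite BA /=.
  by rewrite -(mxrank_leqif_sup BA).2 (eqP fB) (eqP fA).
- exact: (rows_cons Hc HB').
move=> v Hv vA.
pose k := Num.floor (lsubmx (v *m N) 0 0 / t0).
pose v1 := v - k%:~R *: c.
have Hv1 : H v1 by apply: SgrB => //; exact: Sgr_intr.
have v1A : (v1 <= A)%MS by rewrite addmx_sub// eqmx_opp scalemx_sub.
pose t1 := lsubmx (v1 *m N) 0 0.
have t1E : t1 = lsubmx (v *m N) 0 0 - k%:~R * t0.
  by rewrite /t1 /v1 /t0 mulmxBl -scalemxAl linearB linearZ /= !mxE.
have /andP[t1_ge0 t1_lt] : 0 <= t1 < t0.
  have := floor_le (lsubmx (v *m N) 0 0 / t0); have := floorD1_gt (lsubmx (v *m N) 0 0 / t0).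
  rewrite -/k intrD ltr_pdivrMr// ler_pdivlMr// t1E mulrDl mul1r => h1 h2.
  by apply/andP; split; lra.
pose f := map_mx Num.floor (rsubmx (v1 *m N)).
pose v2 := v1 - intmx f *m B'.
have Hv2 : H v2 by apply: SgrB => //; exact: Sgr_intmx.
have v2A : (v2 <= A)%MS.
  rewrite addmx_sub// eqmx_opp; apply: submx_trans (submxMl _ _) _.
  by rewrite AE -addsmxE B'A addsmxSr.
have v2N : v2 *m N = row_mx (lsubmx (v1 *m N)) (rsubmx (v1 *m N) - intmx f).
  rewrite /v2 mulmxBl -[intmx f *m B']add0r -(mul0mx _ a) MN.
  by rewrite -{1}[v1 *m N]hsubmxK opp_row_mx add_row_mx subr0.
(* Otherwise [v2] would lie in [K] with a positive first coordinate below the minimum [t0]. *)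
have t10 : t1 = 0.
  apply/eqP; rewrite eq_le t1_ge0 andbT leNgt; apply/negP => t1_gt0.
  have : K v2.
    split=> //; split=> //; rewrite v2N ?row_mxKl ?row_mxKr.
      by rewrite -/t1 t1_gt0 ltW// (lt_le_trans t1_lt).
    rewrite /f; move: (rsubmx (v1 *m N)) => W j; rewrite !mxE.
    have := floor_le (W 0 j); have := floorD1_gt (W 0 j); rewrite intrD => h1 h2.
    by apply/andP; split; lra.
  by move=> /mem_set/cmin; rewrite v2N row_mxKl -/t1 leNgt t1_lt.
have v1A' : (v1 <= dsubmx A)%MS.
  rewrite (NM _ _ v1A) (_ : lsubmx _ = 0) ?mul0mx ?add0r; last first.
    by rewrite [LHS]mx11_scalar -/t1 t10 raddf0.
  by apply: submx_trans (submxMl _ _) _; rewrite B'A.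
have [z v1z] := B'z _ Hv1 v1A'.
exists (row_mx k%:M z : 'rV[int]_(1 + m)).
have -> : intmx (row_mx k%:M z : 'rV[int]_(1 + m)) = row_mx (k%:~R)%:M (intmx z).
  by rewrite [LHS]map_row_mx map_scalar_mx.
rewrite [RHS](_ : _ = (k%:~R)%:M *m c + intmx z *m B'); last exact: (@mul_row_col R 1 1 m d).
rewrite -v1z mul_scalar_mx.
by rewrite addrC subrK.
Qed.

(** A maximal independent family in [H] spans all of [H], so a basis of the part of [H] in its span
    is a basis of [H]. *)
Lemma discrete_basis H : Sgr H -> separated H ->
  exists q (B : 'M[R]_(q, d)), row_free B /\
    forall v, H v <-> exists z, v = intmx z *m B.
Proof.
move=> SH sepH.
pose P m := `[< exists A : 'M[R]_(m, d), row_free A /\ forall i, H (row i A) >].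
have P0 : exists m, P m.
  exists 0%N; apply/asboolP; exists 0; split; last by case.
  by rewrite /row_free mxrank0.
have Pd m : P m -> (m <= d)%N.
  by move=> /asboolP[A [/eqP fA _]]; rewrite -fA; exact: rank_leq_col.
have [m /asboolP[A [fA HA]] mmax] := ex_maxnP P0 Pd.
have [B [fB BA HB Bz]] := discrete_basis_in SH sepH fA HA.
exists m, B; split=> // v; split=> [Hv|[z ->]]; last exact: Sgr_intmx.
apply: Bz => //; apply: contraT => vA.
suff /mmax : P m.+1 by rewrite ltnn.
apply/asboolP; exists (col_mx v A).
by split; [exact: row_free_cons|exact: (rows_cons Hv HA)].
Qed.

(** A subspace of maximal dimension inside [H] contains every line of [H], because adjoining the
    direction of a line stays inside [H]. *)
Lemma Sgr_lines H : Sgr H -> exists p (P : 'M[R]_(p, d)),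
  [/\ row_free P, forall u : 'rV[R]_p, H (u *m P) &
    forall w, (forall t : R, H (t *: w)) -> (w <= P)%MS].
Proof.
move=> SH; pose P m := `[< exists A : 'M[R]_(m, d),
  row_free A /\ forall u : 'rV[R]_m, H (u *m A) >].
have P0 : exists m, P m.
  exists 0%N; apply/asboolP; exists 0; split; first by rewrite /row_free mxrank0.
  by move=> u; rewrite mulmx0; case: SH.
have Pd m : P m -> (m <= d)%N.
  by move=> /asboolP[A [/eqP fA _]]; rewrite -fA; exact: rank_leq_col.
have [m /asboolP[A [fA HA]] mmax] := ex_maxnP P0 Pd.
exists m, A; split=> // w Hw; apply: contraT => wA.
suff /mmax : P m.+1 by rewrite ltnn.
apply/asboolP; exists (col_mx w A); split; first exact: row_free_cons.
move=> u; rewrite -(@hsubmxK R 1 1 m u) (@mul_row_col R 1 1 m d).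
apply: SgrD => //; rewrite [lsubmx _]mx11_scalar mul_scalar_mx; exact: Hw.
Qed.

Lemma mul_colsub l m n k (c : 'I_k -> 'I_n) (u : 'M[R]_(l, m)) (A : 'M[R]_(m, n)) :
  u *m colsub c A = colsub c (u *m A).
Proof. by apply/matrixP => i0 j; rewrite !mxE; apply: eq_bigr => i _; rewrite !mxE. Qed.

(* A coordinate subspace meeting H in a discrete set meets no line of H. *)
Lemma separated_row_free H p p' (P : 'M[R]_(p, d)) (c : 'I_p' -> 'I_d) :
  row_free P -> (forall u : 'rV[R]_p, H (u *m P)) -> separated (H `&` zcoord c) ->
  row_free (colsub c P).
Proof.
move=> fP HP sep; apply: row_free_ker => u cu.
suff : u *m P = 0 *m P by exact: row_free_inj.
rewrite mul0mx; apply: (separated_line sep) => t; rewrite scalemxAl; split=> //.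
by rewrite /zcoord /= -mul_colsub -scalemxAl cu scaler0.
Qed.

Lemma row_free_colsub p (P : 'M[R]_(p, d)) : row_free P ->
  exists c : {ffun 'I_p -> 'I_d}, injective c /\ colsub c P \in unitmx.
Proof.
move=> fP; have fPT : row_full P^T by rewrite /row_full mxrank_tr.
have cE k : finfun (fullrankfun fPT) k = fullrankfun fPT k := ffunE _ k.
exists (finfun (fullrankfun fPT)); split; first by move=> i j; rewrite !cE; exact: fullrankfun_inj.
rewrite -unitmx_tr (_ : _^T = rowsub (fullrankfun fPT) P^T); first exact: fullrowsub_unit.
by apply/matrixP => i j; rewrite !mxE cE.
Qed.

(** Without separation [H] would contain a line within W_c; that line lies in the space of [P],
    which meets W_c only in 0. *)
Lemma unit_separated H p (P : 'M[R]_(p, d)) (c : 'I_p -> 'I_d) : Sgr H ->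
  (forall w, (forall t : R, H (t *: w)) -> (w <= P)%MS) ->
  colsub c P \in unitmx -> separated (H `&` zcoord c).
Proof.
move=> SH HP Pc; apply: contrapT => /(closed_subgroup_line (Sgr_zcoord c SH))[w w0 Hw].
case/negP: w0; have /submxP[u wE] : (w <= P)%MS by apply: HP => t; have [] := Hw t.
have [_] := Hw 1; rewrite scale1r wE /zcoord /= -mul_colsub => cu.
by rewrite -(mulmxK Pc u) cu mul0mx mul0mx.
Qed.

Lemma zcoord_decomposition H p (P : 'M[R]_(p, d)) (c : 'I_p -> 'I_d) : Sgr H ->
  (forall u : 'rV[R]_p, H (u *m P)) -> colsub c P \in unitmx ->
  forall v, exists u : 'rV[R]_p, zcoord c (v - u *m P) /\ (H v -> H (v - u *m P)).
Proof.
move=> SH HP Pc v; exists (colsub c v *m invmx (colsub c P)); split.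
  by rewrite /zcoord /= linearB /= -mul_colsub mulmxKV// subrr.
by move=> Hv; exact: SgrB.
Qed.

Lemma row_free_zcoord p q (P : 'M[R]_(p, d)) (Q : 'M[R]_(q, d)) (c : 'I_p -> 'I_d) :
  colsub c P \in unitmx -> row_free Q -> (forall i, zcoord c (row i Q)) ->
  row_free (col_mx P Q).
Proof.
move=> Pc fQ cQ; apply: row_free_ker => u; rewrite -[u]hsubmxK mul_row_col => uPQ.
have cQ0 : colsub c Q = 0.
  by apply/row_matrixP => i; rewrite row0 -[RHS](cQ i); apply/rowP => j; rewrite !mxE.
have := congr1 (colsub c) uPQ; rewrite linearD /= -!mul_colsub cQ0 mulmx0 addr0 linear0 => uP.
have l0 : lsubmx u = 0 by rewrite -(mulmxK Pc (lsubmx u)) uP mul0mx.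
move: uPQ; rewrite l0 mul0mx add0r -(mul0mx _ Q) => /(row_free_inj fQ) ->.
by rewrite row_mx0.
Qed.

(** Projecting to W_c along L changes a vector by an element of L, so it preserves [H]. Hence [H] is
    the sum of L and its discrete intersection with W_c. *)
Lemma Sgr_split H : Sgr H -> exists p q, (p + q <= d)%N /\ split_sgr p q H.
Proof.
move=> SH; have [p [P [fP HP HL]]] := Sgr_lines SH.
have [c [_ Pc]] := row_free_colsub fP.
have sep := unit_separated SH HL Pc.
have [q [Q [fQ HQ]]] := discrete_basis (Sgr_zcoord c SH) sep.
have fPQ : row_free (col_mx P Q).
  apply: (row_free_zcoord Pc fQ) => i.
  suff [] : (H `&` zcoord c) (row i Q) by [].
  by apply/HQ; exists (delta_mx 0 i); rewrite intmx_delta -rowE.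
exists p, q; split; first by rewrite -(eqP fPQ); exact: rank_leq_col.
exists P, Q; split=> // v; split=> [Hv|[u [z ->]]]; last first.
  apply: SgrD => //; suff [] : (H `&` zcoord c) (intmx z *m Q) by [].
  by apply/HQ; exists z.
have [u [cv /(_ Hv) Hv']] := zcoord_decomposition SH HP Pc v.
have /HQ[z vz] : (H `&` zcoord c) (v - u *m P) by [].
by exists u, z; rewrite -vz addrC subrK.
Qed.

(** Every closed subgroup splits for some pair, and uniqueness identifies this pair with the one
    given by the isomorphism. *)
Lemma Sgr_pqE p q H : Sgr_pq p q H <-> Sgr H /\ split_sgr p q H.
Proof.
split=> [[SH iso]|[SH spl]]; split=> //; last exact: split_sgr_iso.
by have [p' [q' [_ spl]]] := Sgr_split SH; have [-> ->] := iso_split_unique iso spl.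
Qed.

Lemma split_sgr_unique p q p' q' H :
  split_sgr p q H -> split_sgr p' q' H -> p = p' /\ q = q'.
Proof. by move=> /split_sgr_iso; exact: iso_split_unique. Qed.

End Structure.

(** * Measurability of matrix operations and of a least index *)

Section MeasurableHelpers.
Context {disp : measure_display} {T : measurableType disp} {R : realType}.

Lemma measurable_mulmx m n k (A : T -> 'M[R]_(m, n)) (B : T -> 'M[R]_(n, k)) :
  (forall i j, measurable_fun setT (fun x => A x i j)) ->
  (forall i j, measurable_fun setT (fun x => B x i j)) ->
  forall i j, measurable_fun setT (fun x => (A x *m B x) i j).
Proof.
move=> mA mB i j; under eq_fun do rewrite mxE.
by apply: measurable_sum => l; apply: measurable_funM.
Qed.

Lemma measurable_det n (A : T -> 'M[R]_n) :
  (forall i j, measurable_fun setT (fun x => A x i j)) ->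
  measurable_fun setT (fun x => \det (A x)).
Proof.
move=> mA; rewrite /determinant; apply: measurable_sum => s.
by apply: measurable_funM => //; apply: measurable_prod.
Qed.

Lemma measurable_col_mx m n k (A : T -> 'M[R]_(m, k)) (B : T -> 'M[R]_(n, k)) :
  (forall i j, measurable_fun setT (fun x => A x i j)) ->
  (forall i j, measurable_fun setT (fun x => B x i j)) ->
  forall i j, measurable_fun setT (fun x => (col_mx (A x) (B x)) i j).
Proof.
move=> mA mB i j; case: (splitP i) => l il.
  rewrite (_ : i = lshift n l); last exact: val_inj.
  by under eq_fun do rewrite col_mxEu; exact: mA.
rewrite (_ : i = rshift m l); last exact: val_inj.
by under eq_fun do rewrite col_mxEd; exact: mB.
Qed.

Lemma measurable_eq_cst (f : T -> R) (a : R) :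
  measurable_fun setT f -> measurable [set x | f x = a].
Proof. by move=> mf; rewrite -[X in measurable X]setTI; exact: (mf measurableT [set a]). Qed.

Lemma measurable_countable_select disp' (T' : measurableType disp') (N : T -> nat)
    (h : nat -> T -> T') :
  (forall n, measurable [set x | N x = n]) -> (forall n, measurable_fun setT (h n)) ->
  measurable_fun setT (fun x => h (N x) x).
Proof.
move=> mN mh _ B mB; rewrite setTI.
rewrite (_ : _ @^-1` B = \bigcup_n ([set x | N x = n] `&` (h n @^-1` B))).
  apply: bigcupT_measurable => n; apply: measurableI => //.
  by rewrite -[X in measurable X]setTI; exact: mh.
by rewrite predeqE => x; split=> [hB|[n _ [<-]]//]; exists (N x).
Qed.

(* The least n with [P n x], or 0 if there is none. *)
Definition first_index (P : nat -> set T) (x : T) : nat :=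
  xget 0%N [set n | P n x /\ forall k, (k < n)%N -> ~ P k x].

Lemma first_indexP (P : nat -> set T) x : (exists n, P n x) -> P (first_index P x) x.
Proof.
move=> Px; rewrite /first_index; case: xgetP => [n _ []//|].
have ex : exists n, `[< P n x >] by case: Px => n Pn; exists n; apply/asboolP.
case: (ex_minnP ex) => n /asboolP Pn nmin /(_ n)[]; split=> // k kn Pk.
by have := nmin k; rewrite leqNgt kn => /(_ (asboolT Pk)).
Qed.

Lemma measurable_first_index (P : nat -> set T) :
  (forall n, measurable (P n)) -> forall n, measurable [set x | first_index P x = n].
Proof.
move=> mP n; pose G m := P m `&` ~` \bigcup_(k < m) P k.
have mG m : measurable (G m).
  by apply: measurableI => //; apply: measurableC; apply: bigcup_measurable.
have GE m x : G m x <-> (P m x /\ forall k, (k < m)%N -> ~ P k x).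
  split=> -[Pm H]; split=> //; first by move=> k km Pk; apply: H; exists k.
  by move=> [k km Pk]; exact: (H k).
have Gn m x : G m x -> first_index P x = m.
  move=> /GE[Pm H]; rewrite /first_index; case: xgetP => [l _ [Pl Hl]|/(_ m)[]//].
  by case: (ltngtP l m) => // [/H|/Hl].
(* The value 0 arises in two ways: as a genuine least index and as the default. *)
rewrite (_ : mkset _ = G n `|` (if n == 0%N then ~` \bigcup_m P m else set0)).
  apply: measurableU => //; case: ifP => // _; apply: measurableC.
  exact: bigcupT_measurable.
rewrite predeqE => x; have [Px|nPx] := pselect (exists m, P m x).
  split=> [fn|[/Gn//|]].
    left; rewrite -fn; apply/GE; rewrite /first_index; case: xgetP => [l _ //|].
    have := first_indexP Px => _ H; exfalso.
    have ex : exists n, `[< P n x >] by case: Px => l Pl; exists l; apply/asboolP.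
    case: (ex_minnP ex) => l /asboolP Pl lmin; apply: (H l); split=> // k kl Pk.
    by have := lmin k; rewrite leqNgt kl => /(_ (asboolT Pk)).
  by case: eqP => // _ []; case: Px => m Pm; exists m.
have f0 : first_index P x = 0%N.
  by rewrite /first_index xgetPN// => m [Pm _]; apply: nPx; exists m.
split=> [/= <-|[/GE[Pn]|]].
- by right; rewrite f0 eqxx => -[m _ Pm]; apply: nPx; exists m.
- by case: nPx; exists n.
- by case: eqP => // ->.
Qed.

End MeasurableHelpers.

(** * Completing independent rows by unit vectors *)

Section CoordinateRows.
Variable R : realType.

Definition coordmx m n (g : 'I_m -> 'I_n) : 'M[R]_(m, n) := rowsub g 1%:M.

Lemma colsub_coordmx m n (g : 'I_m -> 'I_n) : injective g -> colsub g (coordmx g) = 1%:M.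
Proof. by move=> gi; apply/matrixP => i j; rewrite !mxE (inj_eq gi). Qed.

Lemma colsub_coordmx0 m k n (g : 'I_m -> 'I_n) (f : 'I_k -> 'I_n) :
  (forall i j, g i != f j) -> colsub f (coordmx g) = 0.
Proof. by move=> gf; apply/matrixP => i j; rewrite !mxE (negPf (gf _ _)). Qed.

Lemma basis_completion m r (M : 'M[R]_(m, m + r)) : row_free M ->
  exists g : {ffun 'I_r -> 'I_(m + r)}, col_mx M (coordmx g) \in unitmx.
Proof.
move=> fM; have [f [fi Mf]] := row_free_colsub fM.
(* [M] is invertible on the columns [f], so the unit vectors at all remaining coordinates complete
   it. *)
pose C := (~: (f @: [set: 'I_m]))%SET; have cC : #|C| = r.
  by rewrite cardsCs finset.setCK card_imset// cardsT !card_ord addKn.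
pose g := [ffun k => enum_val (cast_ord (esym cC) k)].
have gi : injective g by move=> i j; rewrite !ffunE => /enum_val_inj/cast_ord_inj.
have gf i j : g i != f j.
  rewrite ffunE; have := enum_valP (cast_ord (esym cC) i).
  by rewrite inE; apply: contraNneq => ->; exact: imset_f.
exists g; rewrite -row_free_unit; apply: row_free_ker => u.
rewrite -[u]hsubmxK mul_row_col => uM.
have := congr1 (colsub f) uM.
rewrite linearD /= -!mul_colsub colsub_coordmx0// mulmx0 addr0 linear0 => uf.
have l0 : lsubmx u = 0 by rewrite -(mulmxK Mf (lsubmx u)) uf mul0mx.
have := congr1 (colsub g) uM.
rewrite l0 mul0mx add0r -mul_colsub colsub_coordmx// mulmx1 linear0 => ->.
by rewrite row_mx0.
Qed.

Lemma coordmx_disjoint m k r n (c : 'I_m -> 'I_n) (Q : 'M[R]_(k, n)) (g : 'I_r -> 'I_n) :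
  row_free (col_mx (col_mx (coordmx c) Q) (coordmx g)) -> forall i j, g j != c i.
Proof.
move=> fM i j; apply/eqP => gc.
have : row_mx (row_mx (delta_mx 0 i) (0 : 'rV[R]_k)) (- delta_mx 0 j : 'rV[R]_r) *m
    col_mx (col_mx (coordmx c) Q) (coordmx g) = 0 *m
    col_mx (col_mx (coordmx c) Q) (coordmx g).
  rewrite !mul_row_col !mul0mx addr0 mulNmx -!rowE.
  by apply/rowP => l; rewrite !mxE gc subrr.
move/(row_free_inj fM); rewrite -row_mx0 => /eq_row_mx[_ /rowP/(_ j)].
by rewrite !mxE !eqxx => /eqP; rewrite oppr_eq0 oner_eq0.
Qed.

End CoordinateRows.

(** * The countable search for a lattice basis and a complement *)

Section Selection.
Variables (R : realType) (p q r : nat).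
Notation d := (p + q + r)%N.
Notation V := 'rV[R]_d.
Notation Y := (hit_space R d).
Local Notation ball_index := ('rV[rat]_d * rat)%type.

Definition zball m (c : 'I_m -> 'I_d) (i : ball_index) : set V :=
  @cball R d i `&` zcoord c.

Lemma zcoord_closed m (c : 'I_m -> 'I_d) : closed (@zcoord R d m c).
Proof.
have [+ _ _] : Sgr ([set: V] `&` zcoord c); last by rewrite setTI.
by apply: Sgr_zcoord; split=> //; exact: closedT.
Qed.

Lemma compactI_zcoord m (c : 'I_m -> 'I_d) (K : set V) :
  compact K -> compact (K `&` zcoord c).
Proof. by move=> cK; apply: compact_closedI => //; exact: zcoord_closed. Qed.

Definition annulus (n : nat) : set V :=
  [set v | n.+1%:R^-1 <= `|v| <= 2 * n.+1%:R^-1].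

Lemma annulus_compact n : compact (annulus n).
Proof.
apply: bounded_closed_compact.
  exists (2 * n.+1%:R^-1); split; first exact: num_real.
  by move=> M Mn v /= /andP[_ vn]; exact: le_trans (ltW Mn).
change (closed ((fun v : V => `|v|) @^-1` `[n.+1%:R^-1, 2 * n.+1%:R^-1]%classic)).
by apply: preimage_closed; [move=> v _; exact: norm_continuous|exact: itv_closed].
Qed.

(** Separatedness in measurable form: some compact annulus within W_c is missed. The closure makes
    the condition measurable on arbitrary sets. *)
Definition zcoord_discrete m (c : 'I_m -> 'I_d) : set Y :=
  \bigcup_n ~` [set F : set V | closure F `&` (annulus n `&` zcoord c) !=set0].

Lemma measurable_zcoord_discrete m (c : 'I_m -> 'I_d) : measurable (zcoord_discrete c).
Proof.
apply: bigcupT_measurable => n; apply: measurableC.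
apply: measurable_closure_hit; apply: compactI_zcoord; exact: annulus_compact.
Qed.

Lemma Sgr_closureE (F : set V) : Sgr F -> closure F = F.
Proof. by case=> + _ _; rewrite closure_id => <-. Qed.

Lemma zcoord_discreteE m (c : 'I_m -> 'I_d) (F : set V) : Sgr F ->
  zcoord_discrete c F <-> separated (F `&` zcoord c).
Proof.
move=> SF; rewrite (separated_annulus (Sgr_zcoord c SF)).
split=> [[n _ Hn]|[n Hn]]; exists n => //.
  by move=> [v [[Fv cv] vn]]; apply: Hn; exists v; rewrite Sgr_closureE.
by move=> [v]; rewrite Sgr_closureE// => -[Fv [vn cv]]; apply: Hn; exists v.
Qed.

Definition zpoint (c : 'I_p -> 'I_d) (i : ball_index) : Y -> V :=
  pick_point (zball c i).

Lemma measurable_zpoint c i k : measurable_fun setT (fun F => zpoint c i F 0 k).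
Proof.
apply: measurable_coord; apply: measurable_pick_point.
by apply: compactI_zcoord; exact: cball_compact.
Qed.

(** The default value 0 also belongs to the subgroup, so no case distinction is left to later
    arguments. *)
Lemma zpointP c i (F : set V) : Sgr F -> (F `&` zcoord c) (zpoint c i F).
Proof.
move=> SF; rewrite /zpoint /pick_point; case: xgetP => [v _ /= Fv|_].
  have : (closure F `&` zball c i) v by rewrite Fv.
  by rewrite Sgr_closureE// => -[? []].
by case: (Sgr_zcoord c SF).
Qed.

(** In a ball of radius at most the separation constant around w, no other point of the lattice
    remains. *)
Lemma zpoint_surj c (F : set V) w : Sgr F -> separated (F `&` zcoord c) ->
  (F `&` zcoord c) w -> exists i, zpoint c i F = w.
Proof.
move=> SF [e e0 He] Fw; have [i [iw ie]] := cball_sub (nbhsx_ballx w _ e0).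
exists i; apply: pick_pointE; rewrite Sgr_closureE//.
have SG := Sgr_zcoord c SF.
rewrite predeqE => v; split=> [[Fv [iv cv]]|->]; last first.
  by case: Fw => Fw cw; split=> //; split=> //; exact: rball_cball.
apply/eqP; apply: contraT; rewrite eq_sym -subr_eq0 => vw.
have /(He _)/(_ vw) : (F `&` zcoord c) (w - v) by exact: SgrB.
by have /ie/ball_normP := iv; rewrite ltNge => /negP.
Qed.

Definition choice_index :=
  ({ffun 'I_p -> 'I_d} * {ffun 'I_q -> ball_index} * {ffun 'I_r -> 'I_d})%type.

Definition zpoints (w : choice_index) (F : Y) : 'M[R]_(q, d) :=
  \matrix_j zpoint w.1.1 (w.1.2 j) F.

(** The unit vectors at the coordinates c occupy the place of a basis of L. *)
Definition frame (w : choice_index) (F : Y) : 'M[R]_(p + q + r) :=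
  col_mx (col_mx (coordmx R w.1.1) (zpoints w F)) (coordmx R w.2).

(** In the discrete case the points [zpoint] exhaust the lattice part of [F], so the second
    condition says that the chosen ones generate it. *)
Definition good (w : choice_index) : set Y :=
  [set F | [/\ zcoord_discrete w.1.1 F,
    forall i, exists z, zpoint w.1.1 i F = intmx R z *m zpoints w F,
    forall j, zcoord w.1.1 (row j (coordmx R w.2)) & frame w F \in unitmx]].

Lemma measurable_zpoints w i j : measurable_fun setT (fun F => zpoints w F i j).
Proof.
rewrite (_ : (fun F => _) = (fun F => zpoint w.1.1 (w.1.2 i) F 0 j)).
  exact: measurable_zpoint.
by apply/funext => F; rewrite mxE.
Qed.

Lemma measurable_good w : measurable (good w).
Proof.
rewrite (_ : good w = zcoord_discrete w.1.1 `&`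
  (\bigcap_i \bigcup_z \bigcap_k
     [set F | zpoint w.1.1 i F 0 k - (intmx R z *m zpoints w F) 0 k = 0]) `&`
  (if `[<forall j, zcoord w.1.1 (row j (coordmx R w.2))>] then
     ~` [set F | \det (frame w F) = 0] else set0)).
  apply: measurableI; first apply: measurableI; first exact: measurable_zcoord_discrete.
    rewrite -[X in measurable X]setCK setC_bigcap; apply: measurableC.
    apply: countable_bigcupT_measurable => [|i]; first exact: countableP.
    apply: measurableC; apply: countable_bigcupT_measurable => [|z]; first exact: countableP.
    apply: fin_bigcap_measurable => // k _; apply: measurable_eq_cst.
    apply: measurable_funB; first exact: measurable_zpoint.
    by apply: measurable_mulmx => // *; exact: measurable_zpoints.
  case: asboolP => // _; apply: measurableC; apply: measurable_eq_cst.
  apply: measurable_det; apply: measurable_col_mx => [|i j]; last exact: measurable_cst.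
  by apply: measurable_col_mx => i j; [exact: measurable_cst|exact: measurable_zpoints].
rewrite predeqE => F; split=> [[dF zF cF uF]|[[dF zF]]].
  split; last first.
    by case: asboolP => // _; apply/eqP; rewrite -unitfE -unitmxE.
  split=> // i _; have [z iz] := zF i; exists z => // k _ /=.
  by rewrite -iz subrr.
case: asboolP => // cF uF; split=> //; last by rewrite unitmxE unitfE; exact/eqP.
move=> i; have [z _ iz] := zF i I; exists z; apply/rowP => k; apply/eqP.
by rewrite -subr_eq0; apply/eqP; exact: iz.
Qed.

Definition framed (w : choice_index) (F : set V) := exists P : 'M[R]_(p, d),
  spans F P (zpoints w F) /\ row_free (col_mx P (col_mx (zpoints w F) (coordmx R w.2))).

(** For a closed subgroup this means dim L < p. *)
Definition lower_rank : set Y :=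
  \bigcup_(m : 'I_p) \bigcup_(c : {ffun 'I_m -> 'I_d}) zcoord_discrete c.

Lemma measurable_lower_rank : measurable lower_rank.
Proof.
apply: countable_bigcupT_measurable => [|m]; first exact: countableP.
apply: countable_bigcupT_measurable => [|c]; first exact: countableP.
exact: measurable_zcoord_discrete.
Qed.

Lemma good_framed w F : Sgr F -> ~ lower_rank F -> good w F -> framed w F.
Proof.
move=> SF nlow [/(zcoord_discreteE _ SF) sepF zF cF uF].
have [p0 [P [fP HP HL]]] := Sgr_lines SF.
have [c0 [_ Pc0]] := row_free_colsub fP.
(* Discreteness bounds dim L by p; were it smaller, the pivot columns [c0] would put [F] into
   [lower_rank]. *)
have p0p : p0 = p.
  apply/eqP; rewrite eqn_leq; apply/andP; split.
    by rewrite -(eqP (separated_row_free fP HP sepF)); exact: rank_leq_col.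
  rewrite leqNgt; apply/negP => p0p; apply: nlow.
  exists (Ordinal p0p) => //; exists c0 => //; apply/zcoord_discreteE => //.
  exact: unit_separated HL Pc0.
subst p0.
have Pc : colsub w.1.1 P \in unitmx by rewrite -row_free_unit; exact: separated_row_free sepF.
have zrow j : row j (zpoints w F) = zpoint w.1.1 (w.1.2 j) F by rewrite rowK.
exists P; split=> [v|].
  split=> [Fv|[u [z ->]]]; last first.
    apply: SgrD => //; apply: Sgr_intmx => // j; rewrite zrow.
    by have [] := zpointP w.1.1 (w.1.2 j) SF.
  have [u [cv /(_ Fv) Fvu]] := zcoord_decomposition SF HP Pc v.
  have [i iv] := zpoint_surj SF sepF (conj Fvu cv).
  have [z zi] := zF i; exists u, z; by rewrite -zi iv addrC subrK.
apply: (row_free_zcoord Pc).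
  apply: row_free_ker => u; rewrite -[u]hsubmxK mul_row_col => uM.
  have : row_mx (row_mx 0 (lsubmx u)) (rsubmx u) *m frame w F = 0 *m frame w F.
    by rewrite /frame !mul_row_col !mul0mx add0r uM.
  move: (uF); rewrite -row_free_unit => fF /(row_free_inj fF).
  by rewrite -row_mx0 => /eq_row_mx[]; rewrite -row_mx0 => /eq_row_mx[_ ->] ->; rewrite row_mx0.
move=> i; case: (splitP i) => j ij.
  rewrite (_ : i = lshift r j); last exact: val_inj.
  by rewrite rowKu zrow; have [] := zpointP w.1.1 (w.1.2 j) SF.
rewrite (_ : i = rshift q j); last exact: val_inj.
by rewrite rowKd; exact: cF.
Qed.

Lemma split_sgr_good F : Sgr F -> split_sgr p q F -> ~ lower_rank F /\ exists w, good w F.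
Proof.
move=> SF [P [Q [fPQ FPQ]]].
have fP := row_free_col_mxl fPQ.
have HP u : F (u *m P).
  apply/FPQ; exists u, 0; rewrite (_ : intmx R 0 = 0) ?mul0mx ?addr0//.
  by apply/rowP => j; rewrite !mxE.
split.
  move=> [m _ [c _ /(zcoord_discreteE _ SF) sep]].
  have := rank_leq_col (colsub c P); rewrite (eqP (separated_row_free fP HP sep)).
  by rewrite leqNgt ltn_ord.
have HL := spans_mulr_line fPQ FPQ.
have [c [ci Pc]] := row_free_colsub fP.
have sep := unit_separated SF HL Pc.
(* [Q'] is [Q] pushed into W_c along the space of [P], which does not leave [F]. *)
pose T := colsub c Q *m invmx (colsub c P); pose Q' := Q - T *m P.
have cQ' : colsub c Q' = 0.
  by rewrite linearB /= -mul_colsub mulmxKV// subrr.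
have cQ'r j : zcoord c (row j Q').
  have : row j (colsub c Q') = 0 by rewrite cQ' row0.
  by rewrite /zcoord /= => <-; apply/rowP => k; rewrite !mxE.
have FQ' j : (F `&` zcoord c) (row j Q').
  split=> //; apply/FPQ; exists (- row j T), (delta_mx 0 j).
  by rewrite intmx_delta -rowE linearB /= row_mul mulNmx addrC.
have fQ' : row_free Q'.
  apply: row_free_ker => u uQ'.
  have : row_mx (- (u *m T)) u *m col_mx P Q = row_mx 0 0 *m col_mx P Q.
    rewrite !mul_row_col !mul0mx addr0 mulNmx addrC -mulmxA -mulmxBr.
    exact: uQ'.
  by move/(row_free_inj fPQ)/eq_row_mx => [].
have [K KQ'] : exists K : {ffun 'I_q -> ball_index}, forall j, zpoint c (K j) F = row j Q'.
  exists [ffun j => sval (cid (zpoint_surj SF sep (FQ' j)))] => j.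
  by rewrite ffunE; case: cid.
have cc : colsub c (coordmx R c) = 1%:M by exact: colsub_coordmx.
have fE : row_free (col_mx (coordmx R c) Q').
  by apply: (row_free_zcoord (c := c)) => //; rewrite cc unitmx1.
have [g gu] := basis_completion fE.
have zE : zpoints (c, K, g) F = Q' by apply/row_matrixP => j; rewrite rowK KQ'.
exists (c, K, g); split=> /=; first exact/zcoord_discreteE.
(* In the expansion over [P] and [Q'] the first part vanishes, since the point and the rows of [Q']
   lie in W_c. *)
- move=> i; rewrite zE; have [/FPQ[u [z iE]] ci0] := zpointP c i SF.
  exists z; rewrite iE; have iE' : zpoint c i F = (u + intmx R z *m T) *m P + intmx R z *m Q'.
    by rewrite iE mulmxDl mulmxBr (mulmxA _ T P) addrACA subrr addr0.
  move: ci0; rewrite /zcoord /= iE' linearD /= -!mul_colsub cQ' mulmx0 addr0 => u0.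
  have u0' : u + intmx R z *m T = 0 by rewrite -(mulmxK Pc (u + _)) u0 mul0mx.
  by rewrite -iE iE' u0' mul0mx add0r.
- move=> j; apply/rowP => i; rewrite !mxE; case: eqP => // gc.
  by move: gu; rewrite -row_free_unit => /coordmx_disjoint/(_ i j)/eqP; rewrite gc.
- by rewrite /frame zE.
Qed.

End Selection.

(** * Measurable beta and gamma from the first good choice *)

Section FrameSelection.
Variables (R : realType) (p q r : nat).
Notation d := (p + q + r)%N.
Notation V := 'rV[R]_d.
Notation Y := (hit_space R d).
Local Notation Omega := (choice_index p q r).

Definition nth_good (n : nat) : set Y :=
  if choice.unpickle n is Some w then good (w : Omega) else set0.

Lemma measurable_nth_good n : measurable (nth_good n).
Proof.
by rewrite /nth_good; case: choice.unpickle => // w; exact: measurable_good.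
Qed.

Definition frame_beta (j : 'I_q) (F : Y) : V :=
  if choice.unpickle (first_index nth_good F) is Some w
  then row j (zpoints (w : Omega) F) else 0.

Definition frame_gamma (k : 'I_r) (F : Y) : V :=
  if choice.unpickle (first_index nth_good F) is Some w
  then row k (coordmx R (w : Omega).2) else 0.

Lemma measurable_frame_beta j : measurable_fun setT (frame_beta j : Y -> borel V).
Proof.
apply: (@measurable_countable_select _ Y _ (borel V) (first_index nth_good)
  (fun n F => if choice.unpickle n is Some w then row j (zpoints (w : Omega) F) else 0)).
  by apply: measurable_first_index; exact: measurable_nth_good.
move=> n; case: choice.unpickle => [w|]; last exact: measurable_cst.
apply: measurable_fun_rV => i.
rewrite (_ : (fun F => _) = (fun F => zpoints w F j i)); first exact: measurable_zpoints.
by apply/funext => F; rewrite mxE.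
Qed.

Lemma measurable_frame_gamma k : measurable_fun setT (frame_gamma k : Y -> borel V).
Proof.
apply: (@measurable_countable_select _ Y _ (borel V) (first_index nth_good)
  (fun n F => if choice.unpickle n is Some w then row k (coordmx R (w : Omega).2) else 0)).
  by apply: measurable_first_index; exact: measurable_nth_good.
by move=> n; case: choice.unpickle => [w|]; exact: measurable_cst.
Qed.

Lemma frame_split (F : set V) : Sgr F -> split_sgr p q F ->
  exists P : 'M[R]_(p, d), spans F P (\matrix_j frame_beta j F) /\
    row_free (col_mx P (col_mx (\matrix_j frame_beta j F) (\matrix_k frame_gamma k F))).
Proof.
move=> SF /(split_sgr_good (r := r) SF)[nlow [w gw]].
have ex : exists n, nth_good n F.
  by exists (choice.pickle w); rewrite /nth_good choice.pickleK.
have := @first_indexP _ Y nth_good F ex; rewrite /nth_good /frame_beta /frame_gamma.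
case: choice.unpickle => // w' gw'; have [P [FP fP]] := good_framed SF nlow gw'.
have -> : \matrix_j row j (zpoints w' F) = zpoints w' F by apply/row_matrixP => j; rewrite rowK.
have -> : \matrix_k row k (coordmx R w'.2) = coordmx R w'.2 by apply/row_matrixP => j; rewrite rowK.
by exists P.
Qed.

(** The same search decides the type (p, q): some choice succeeds with p coordinates and no shorter
    list of coordinates gives a discrete intersection. *)
Lemma measurable_split_sgr : exists2 D : set Y, measurable D &
  forall F : set V, Sgr F -> (D F <-> split_sgr p q F).
Proof.
exists (~` @lower_rank R p q r `&` \bigcup_w @good R p q r w).
  apply: measurableI; first by apply: measurableC; exact: measurable_lower_rank.
  apply: countable_bigcupT_measurable => [|w]; first exact: countableP.
  exact: measurable_good.
move=> F SF; split=> [[nlow [w _ gw]]|/(split_sgr_good (r := r) SF)[nlow [w gw]]]; last first.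
  by split=> //; exists w.
have [P [FP fP]] := good_framed SF nlow gw; exists P, (zpoints w F); split=> //.
apply: row_free_ker => u; rewrite -[u]hsubmxK mul_row_col => uPQ.
have : row_mx (lsubmx u) (row_mx (rsubmx u) 0) *m
    col_mx P (col_mx (zpoints w F) (coordmx R w.2)) = 0 *m
    col_mx P (col_mx (zpoints w F) (coordmx R w.2)).
  by rewrite !mul_row_col !mul0mx addr0.
move/(row_free_inj fP); rewrite -row_mx0 => /eq_row_mx[->].
by rewrite -row_mx0 => /eq_row_mx[-> _]; rewrite row_mx0.
Qed.

End FrameSelection.

(** * A Borel section of R -> T *)

Section TorusSection.
Variable R : realType.
Local Notation pi := (@torus_pi R).

Lemma torus_pi0 : pi 0 = 0.
Proof. by rewrite -[X in pi X](subrr 0) torus_piB subrr. Qed.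

Lemma torus_piD x y : pi (x + y) = pi x + pi y.
Proof. by rewrite -[y in LHS]opprK -[- y]sub0r !torus_piB torus_pi0 sub0r opprK. Qed.

Definition torus_frac (a : torus R) : R :=
  let x := sval (cid (torus_pi_surj a)) in x - (Num.floor x)%:~R.

Lemma torus_fracK : cancel torus_frac pi.
Proof.
move=> a; rewrite /torus_frac; case: cid => x /= <-.
by apply/torus_pi_eq; exists (- Num.floor x); rewrite mulrNz addrAC subrr add0r.
Qed.

Lemma torus_frac_itv a : 0 <= torus_frac a < 1.
Proof.
rewrite /torus_frac; set x := sval _.
have := floor_le x; have := floorD1_gt x; rewrite intrD => h1 h2.
by apply/andP; split; lra.
Qed.

Lemma torus_fracE x : 0 <= x < 1 -> torus_frac (pi x) = x.
Proof.
move=> /andP[x0 x1]; have /andP[y0 y1] := torus_frac_itv (pi x).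
have /torus_pi_eq[n xy] := torus_fracK (pi x).
have n1 : `|n| < 1.
  rewrite -(ltr_int R) intr_norm -xy ltr_norml; apply/andP; split; lra.
have n0 : n = 0 by lia.
by apply/eqP; rewrite -subr_eq0 xy n0.
Qed.

(** The section jumps at 0, but for c >= 0 the preimage of the ray above c is the image of the
    interval (c, 1) under an open map. *)
Lemma measurable_torus_frac : measurable_fun setT (torus_frac : borel (torus R) -> R).
Proof.
apply: (measurability _ (RGenOInfty.measurableE R)).
move=> _ [_ [c ->] <-]; rewrite setTI.
have [c0|c0] := ltP c 0.
  rewrite (_ : _ @^-1` _ = setT) // predeqE => a; split=> // _.
  by rewrite /= in_itv /= andbT (lt_le_trans c0)//; case/andP: (torus_frac_itv a).
apply: (@sub_sigma_algebra _ setT (@open (torus R))).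
rewrite (_ : _ @^-1` _ = pi @` `]c, 1[%classic).
  rewrite openE => _ [x xc <-]; apply: torus_pi_nbhs.
  by apply: open_nbhs_nbhs; split=> //; exact: interval_open.
rewrite predeqE => a; split=> [|[x] + <-]; rewrite /= !in_itv /= andbT => ca.
  exists (torus_frac a); last exact: torus_fracK.
  by rewrite /= in_itv /= ca; case/andP: (torus_frac_itv a).
case/andP: ca => cx x1; rewrite torus_fracE// x1 andbT.
exact: le_trans c0 (ltW cx).
Qed.

End TorusSection.

(** * The free action of R^r x T^q on a stratum *)

Section QuotientAction.
Variables (R : realType) (p q r : nat) (disp : measure_display).
Notation d := (p + q + r)%N.
Notation V := 'rV[R]_d.
Variables (X : measurableType disp) (flow : X -> V -> X).
Hypothesis sX : standard_borel R X.
Hypothesis Hflow : borel_action setT flow.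

Lemma stratumE x : stratum flow p q x <-> split_sgr p q (stab flow x).
Proof.
split=> [/Sgr_pqE[]//|H]; apply/Sgr_pqE; split=> //; exact: stab_Sgr.
Qed.

Lemma measurable_stratum : measurable (stratum flow p q).
Proof.
have [D mD HD] := @measurable_split_sgr R p q r.
rewrite (_ : stratum flow p q = stab flow @^-1` D).
  by rewrite -[X in measurable X]setTI; exact: (measurable_stab sX Hflow).
by rewrite predeqE => x; rewrite stratumE -HD//; exact: stab_Sgr.
Qed.

Lemma invariant_stratum : invariant_set flow (stratum flow p q).
Proof. by move=> x v; rewrite /stratum /= stab_flow. Qed.

Let beta x : 'M[R]_(q, d) := \matrix_j @frame_beta R p q r j (stab flow x).
Let gamma x : 'M[R]_(r, d) := \matrix_k @frame_gamma R p q r k (stab flow x).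

Definition frame_vector x (s : 'rV[R]_r) (t : 'rV[R]_q) : V :=
  s *m gamma x + t *m beta x.

Lemma frame_vectorE x s t : frame_vector x s t =
  \sum_(k < r) s 0 k *: @frame_gamma R p q r k (stab flow x) +
  \sum_(j < q) t 0 j *: @frame_beta R p q r j (stab flow x).
Proof.
rewrite /frame_vector !mulmx_sum_row.
by congr (_ + _); apply: eq_bigr => k _; rewrite rowK.
Qed.

Definition frame_act x (g : RrTq R r q) : X :=
  flow x (frame_vector x g.1 (map_mx (@torus_frac R) g.2)).

(** Another representative of t differs by integers, which moves the vector by an element of the
    stabilizer. *)
Lemma frame_actE x s t : stratum flow p q x ->
  frame_act x (s, map_mx (@torus_pi R) t) = flow x (frame_vector x s t).
Proof.
move=> /stratumE; move=> /(frame_split (r := r) (stab_Sgr sX Hflow x))[P [FP _]].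
rewrite /frame_act /=; set t' := map_mx _ (map_mx _ t).
have [z tz] : exists z : 'rV[int]_q, t' = intmx R z + t.
  have tz j : exists n : int, torus_frac (torus_pi (t 0 j)) - t 0 j = n%:~R.
    by apply/torus_pi_eq; rewrite torus_fracK.
  exists (\row_j sval (cid (tz j))); apply/rowP => j; rewrite !mxE.
  by case: cid => n /= <-; rewrite subrK.
rewrite tz /frame_vector mulmxDl addrCA flowD//; congr (flow _ _).
by apply/FP; exists 0, z; rewrite mul0mx add0r.
Qed.

Lemma frame_vector_flow x v s t :
  frame_vector (flow x v) s t = frame_vector x s t.
Proof. by rewrite /frame_vector /gamma /beta !stab_flow. Qed.

Lemma RrTq_repr (g : RrTq R r q) :
  g = (g.1, map_mx (@torus_pi R) (map_mx (@torus_frac R) g.2)).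
Proof.
case: g => s t /=; congr (_, _).
by apply/rowP => j; rewrite !mxE torus_fracK.
Qed.

Lemma measurable_frame_act :
  measurable_fun setT (fun xg : X * borel (RrTq R r q) => frame_act xg.1 xg.2).
Proof.
have mstab := measurable_stab sX Hflow.
pose vec (xg : X * borel (RrTq R r q)) : V :=
  frame_vector xg.1 xg.2.1 (map_mx (@torus_frac R) xg.2.2).
suff mvec : measurable_fun setT (vec : X * borel (RrTq R r q) -> borel V).
  apply: (@measurableT_comp _ _ _ _ (X * borel V)%type _
    (fun xv : X * borel V => flow xv.1 xv.2) _ (fun xg => (xg.1, vec xg : borel V))).
    exact: measurable_flow.
  by apply: (@measurable_fun_pair _ _ _ _ _ (borel V)) => //; exact: measurable_fst.
have mfst := @measurable_fst _ _ X (borel (RrTq R r q)).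
have msnd := @measurable_snd _ _ X (borel (RrTq R r q)).
(* The sigma-algebra of the group comes from its product topology, so coordinates are measurable
   because they are continuous. *)
have mg1 k : measurable_fun setT (fun xg : X * borel (RrTq R r q) => (xg.2 : RrTq R r q).1 0 k).
  apply: (@measurableT_comp _ _ _ _ (borel (RrTq R r q)) _ (fun g : RrTq R r q => g.1 0 k)) => //.
  apply: continuous_measurable_borelR => g.
  apply: (@continuous_comp _ _ _ (fun g : RrTq R r q => g.1) (fun s : 'rV[R]_r => s 0 k)).
    exact: cvg_fst.
  exact: coord_continuous.
have mg2 j : measurable_fun setT
    (fun xg : X * borel (RrTq R r q) => torus_frac ((xg.2 : RrTq R r q).2 0 j)).
  apply: (@measurableT_comp _ _ _ _ (borel (RrTq R r q)) _
    (fun g : RrTq R r q => torus_frac (g.2 0 j))) => //.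
  apply: (@measurableT_comp _ _ _ (borel (RrTq R r q)) (borel (torus R)) _ (@torus_frac R) _
    (fun g : borel (RrTq R r q) => (g : RrTq R r q).2 0 j : borel (torus R))); first exact: measurable_torus_frac.
  apply: continuous_measurable_borel => -[s t] U /= nU.
  exists (setT, [set t' : 'rV[torus R]_q | U (t' 0 j)]); last by move=> [s' t'] [].
  split; first exact: filterT.
  exists (fun i l => if l == j then U else setT) => [i l|t' /(_ 0 j)]; last by rewrite /= eqxx.
  by case: eqP => [->|_]; [rewrite ord1|exact: filterT].
apply: measurable_fun_rV => i.
rewrite (_ : (fun x => _) = (fun xg : X * borel (RrTq R r q) =>
   (\sum_k (xg.2 : RrTq R r q).1 0 k * frame_gamma k (stab flow xg.1) 0 i) +
   (\sum_j torus_frac ((xg.2 : RrTq R r q).2 0 j) * frame_beta j (stab flow xg.1) 0 i))).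
  apply: measurable_funD; apply: measurable_sum => k; apply: measurable_funM => //.
    apply: (measurable_coord i).
    exact: (measurableT_comp (measurable_frame_gamma k) (measurableT_comp mstab mfst)).
  apply: (measurable_coord i).
  exact: (measurableT_comp (measurable_frame_beta k) (measurableT_comp mstab mfst)).
apply/funext => xg; rewrite /vec frame_vectorE mxE !summxE.
by congr (_ + _); apply: eq_bigr => k _; rewrite !mxE.
Qed.

Lemma frame_act_borel : borel_action (stratum flow p q) frame_act.
Proof.
split.
- exact: measurable_stratum.
- by move=> x g; exact: invariant_stratum.
- move=> x Hx; rewrite (_ : 0 = (0, map_mx (@torus_pi R) 0)).
    by rewrite frame_actE// /frame_vector !mul0mx addr0 flow0.
  by congr (_, _); apply/rowP => j; rewrite !mxE torus_pi0.
- move=> x g h Hx.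
  (* [torus_frac] is not additive; the sum of two representatives still represents the sum. *)
  have -> : g + h = (g.1 + h.1,
      map_mx (@torus_pi R) (map_mx (@torus_frac R) g.2 + map_mx (@torus_frac R) h.2)).
    rewrite (_ : g + h = (g.1 + h.1, g.2 + h.2)) //; congr (_, _).
    by apply/rowP => j; rewrite !mxE torus_piD !torus_fracK.
  rewrite frame_actE// {2}/frame_act /frame_act frame_vector_flow -flowD//.
  by congr (flow x _); rewrite /frame_vector !mulmxDl addrACA.
- by apply: measurable_funTS; exact: measurable_frame_act.
Qed.

(** A frame vector in the stabilizer also expands over [P] and beta with integer beta coordinates;
    independence makes s vanish and t integral. *)
Lemma frame_act_free : free_action (stratum flow p q) frame_act.
Proof.
move=> x g /stratumE /(frame_split (r := r) (stab_Sgr sX Hflow x))[P [FP fP]].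
rewrite /frame_act => /FP[u [z E]].
have : row_mx (- u) (row_mx (map_mx (@torus_frac R) g.2 - intmx R z) g.1) *m
    col_mx P (col_mx (beta x) (gamma x)) = 0 *m col_mx P (col_mx (beta x) (gamma x)).
  rewrite !mul_row_col mul0mx mulmxBl mulNmx -[RHS](subrr (u *m P + intmx R z *m beta x)).
  rewrite -[X in _ = X - _]E /frame_vector.
  move: (u *m P) (_ *m beta x) (intmx R z *m beta x) (g.1 *m gamma x) => a b c e.
  by apply/rowP => i; rewrite !mxE; ring.
move/(row_free_inj fP); rewrite -row_mx0 => /eq_row_mx[_].
rewrite -row_mx0 => /eq_row_mx[/eqP]; rewrite subr_eq0 => /eqP tz s0.
rewrite [g]RrTq_repr s0 tz; congr (_, _); apply/rowP => j; rewrite !mxE.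
by rewrite -torus_pi0; apply/torus_pi_eq; exists (z 0 j); rewrite subr0.
Qed.

(** [P], beta and gamma together span R^d, and the [P] part of a vector fixes x. *)
Lemma frame_act_orbit x : stratum flow p q x ->
  orbit_of frame_act x = orbit_of flow x.
Proof.
move=> Hx; rewrite predeqE => y; split=> [[g _ <-]|[v _ <-]]; first by eexists.
have /stratumE /(frame_split (r := r) (stab_Sgr sX Hflow x))[P [FP fP]] := Hx.
pose M : 'M[R]_(p + (q + r), d) := col_mx P (col_mx (beta x) (gamma x)).
have /submxP[w vw] : (v <= M)%MS.
  by apply: submx_full; rewrite /row_full (eqP (fP : row_free M)) addnA.
exists (rsubmx (rsubmx w), map_mx (@torus_pi R) (lsubmx (rsubmx w))) => //.
rewrite frame_actE// vw -[w]hsubmxK mul_row_col [in RHS]flowD//.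
have -> : flow x (lsubmx w *m P) = x.
  apply/FP; exists (lsubmx w), 0; rewrite (_ : intmx R 0 = 0) ?mul0mx ?addr0//.
  by apply/rowP => j; rewrite !mxE.
by rewrite !row_mxKr -[in RHS](hsubmxK (rsubmx w)) mul_row_col /frame_vector addrC.
Qed.

End QuotientAction.

(** The selection is carried out in dimension [p + q + r], so d is first rewritten as such a sum. *)
Lemma stratum_measurable_invariant (R : realType) (d : nat) (disp : measure_display)
    (X : measurableType disp) (flow : X -> 'rV[R]_d -> X) p q :
  standard_borel R X -> borel_action setT flow -> (p + q <= d)%N ->
  invariant_set flow (stratum flow p q) /\ measurable (stratum flow p q).
Proof.
move=> sX Hflow pqd; have dE : (p + q + (d - (p + q)) = d)%N by rewrite subnKC.
move: (d - (p + q))%N dE => r dE; subst d.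
split; [exact: (invariant_stratum Hflow)|exact: measurable_stratum].
Qed.

Theorem mainTheorem4 (R : realType) (d : nat) (disp : measure_display)
    (X : measurableType disp) (flow : X -> 'rV[R]_d -> X) :
  standard_borel R X -> borel_action setT flow ->
  let pairs := [set pq : nat * nat | (pq.1 + pq.2 <= d)%N] in
  let X_ (pq : nat * nat) := stratum flow pq.1 pq.2 in
  [/\ forall pq, pairs pq -> invariant_set flow (X_ pq) /\ measurable (X_ pq),
      [/\ finite_set pairs, trivIset pairs X_
        & \bigcup_(pq in pairs) X_ pq = setT]
    & forall p q r, (p + q + r = d)%N ->
      exists (beta : 'I_q -> set 'rV[R]_d -> 'rV[R]_d)
             (gamma : 'I_r -> set 'rV[R]_d -> 'rV[R]_d),
        [/\ forall j, effros_borel_on (Sgr_pq p q) (beta j),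
            forall k, effros_borel_on (Sgr_pq p q) (gamma k)
          & exists act : X -> RrTq R r q -> X,
            [/\ forall x (s : 'rV[R]_r) (t : 'rV[R]_q), stratum flow p q x ->
                  act x (s, map_mx (@torus_pi R) t) =
                  flow x (\sum_(k < r) s 0 k *: gamma k (stab flow x)
                        + \sum_(j < q) t 0 j *: beta j (stab flow x)),
                borel_action (stratum flow p q) act,
                free_action (stratum flow p q) act
              & forall x, stratum flow p q x ->
                  orbit_of act x = orbit_of flow x]]].
Proof.
move=> sX Hflow pairs X_.
have XE p q x : stratum flow p q x <-> split_sgr p q (stab flow x).
  by split=> [/Sgr_pqE[]//|H]; apply/Sgr_pqE; split=> //; exact: stab_Sgr.
split.
- by move=> [p q] /=; exact: stratum_measurable_invariant.
- split.
  + apply: (@sub_finite_set _ _ (`I_d.+1 `*` `I_d.+1)); last first.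
      by apply: finite_setX; exact: finite_II.
    move=> [p q] /= pqd; rewrite !ltnS; split.
      exact: leq_trans (leq_addr _ _) pqd.
    exact: leq_trans (leq_addl _ _) pqd.
  + move=> [p q] [p' q'] _ _ [x [/XE /= Hx /XE /= Hx']].
    by have [-> ->] := split_sgr_unique Hx Hx'.
  + rewrite predeqE => x; split=> // _.
    have [p [q [pqd H]]] := Sgr_split (stab_Sgr sX Hflow x).
    by exists (p, q) => //; apply/XE.
move=> p q r dE; subst d.
exists (fun j => @frame_beta R p q r j), (fun k => @frame_gamma R p q r k).
have cl : Sgr_pq p q `<=` [set F : set 'rV[R]_(p + q + r) | closed F] by move=> F [[]].
split=> [j|k|].
- by apply: measurable_effros_borel_on => //; exact: measurable_frame_beta.
- by apply: measurable_effros_borel_on => //; exact: measurable_frame_gamma.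
exists (frame_act flow); split.
- by move=> x s t Hx; rewrite frame_actE// frame_vectorE.
- exact: frame_act_borel.
- exact: frame_act_free.
- exact: frame_act_orbit.
Qed.
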